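(* E-MAJ-$2$SAT is in $\mathsf{P}$. In particular, for every $\rho \in (0,1)$, given a 2-CNF $F(\vec x,\vec y)$ over existential variables $\vec x$ and probabilistic variables $\vec y$ with $n$ variables in total, one can determine in $n^{O(\log(1/\rho))}$ time whether there is an assignment $A$ to the existential variables such that at least a $\rho$-fraction of the assignments to the probabilistic variables satisfy $F(A,\vec y)$.
   Context: A 2-CNF is a conjunction of clauses each with at most two literals. E-MAJ-$2$SAT: given a 2-CNF over variables $x_1,\dots,x_{n_1}$ (existential) and $y_1,\dots,y_{n'}$ (probabilistic), decide whether there is an assignment $A$ to the $x$-variables such that $F(A,\vec y)$ has at least $2^{n'-1}$ satisfying assignments to the $y$-variables. *)

(* Defs.v *)
From HB Require Import structures.
From mathcomp Require Import all_boot all_order all_algebra.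
From mathcomp Require Import reals exp.

Set Implicit Arguments.
Unset Strict Implicit.
Unset Printing Implicit Defensive.

Import Order.TTheory GRing.Theory Num.Theory.

Inductive move := MoveLeft | Stay | MoveRight.

(* Two-way infinite tape over G, [None] being the blank.  [ltape] is listed
   from the head outwards; every cell not listed is blank. *)
Record tape (G : Type) := Tape {
  ltape : seq (option G);
  scanned : option G;
  rtape : seq (option G)
}.

Definition blank_tape G : tape G := Tape [::] None [::].

Definition move_tape G (d : move) (t : tape G) : tape G :=
  let: Tape l s r := t in
  match d with
  | Stay => t
  | MoveLeft => Tape (behead l) (head None l) (s :: r)
  | MoveRight => Tape (s :: l) (head None r) (behead r)
  end.

Definition write_tape G (s : option G) (t : tape G) : tape G :=
  Tape (ltape t) s (rtape t).

(* The tape alphabet is [option (bool + tm_work)]: the blank, the two input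
   symbols, and finitely many work symbols.  There are [tm_extra.+1] tapes, and
   the input is on tape 0.  [tm_verdict q] is [None] when [q] is not a halting
   state, and [Some b] when the machine halts in [q] with answer [b]. *)
Record tm := TM {
  tm_extra : nat;
  tm_work : finType;
  tm_state : finType;
  tm_start : tm_state;
  tm_verdict : tm_state -> option bool;
  tm_trans : tm_state ->
             {ffun 'I_tm_extra.+1 -> option (bool + tm_work)} ->
             tm_state *
             {ffun 'I_tm_extra.+1 -> option (bool + tm_work) * move}
}.

Definition tm_config (M : tm) : Type :=
  tm_state M * {ffun 'I_(tm_extra M).+1 -> tape (bool + tm_work M)}.

Definition tm_step (M : tm) (c : tm_config M) : tm_config M :=
  if tm_verdict c.1 is Some _ then c else
  let: (q, act) := tm_trans c.1 [ffun i => scanned (c.2 i)] in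
  (q, [ffun i => move_tape (act i).2 (write_tape (act i).1 (c.2 i))]).

Definition input_tape (W : Type) (w : seq bool) : tape (bool + W) :=
  if w is b :: w' then
    Tape [::] (Some (inl b)) [seq Some (inl a) | a <- w']
  else blank_tape _.

Definition tm_init (M : tm) (w : seq bool) : tm_config M :=
  (tm_start M,
   [ffun i => if i == ord0 then input_tape (tm_work M) w else blank_tape _]).

Definition tm_result (M : tm) (w : seq bool) (t : nat) : option bool :=
  tm_verdict (iter t (@tm_step M) (tm_init M w)).1.

(* On input [w], M halts after at most [t] steps, with the correct answer to
   the question whether [Q] holds. *)
Definition decides_within (M : tm) (w : seq bool) (t : nat) (Q : Prop) : Prop :=
  exists2 b : bool, tm_result M w t = Some b & b <-> Q.

Definition in_P (L : seq bool -> Prop) : Prop :=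
  exists (M : tm) (k : nat),
    forall w : seq bool, decides_within M w (k * size w ^ k + k) (L w).

(* [(inl i, s)] is a literal on x_i and [(inr j, s)] one on y_j; it is positive
   when [s = true] and negated when [s = false]. *)
Definition literal (p q : nat) : finType := (('I_p + 'I_q) * bool)%type.

Record cnf2 := Cnf2 {
  nexist : nat;
  nprob : nat;
  clauses : seq (2.-bseq (literal nexist nprob))
}.

Definition nvars (F : cnf2) : nat := nexist F + nprob F.

Definition xassign (F : cnf2) : finType := {ffun 'I_(nexist F) -> bool}.
Definition yassign (F : cnf2) : finType := {ffun 'I_(nprob F) -> bool}.

Definition lit_true (F : cnf2) (A : xassign F) (B : yassign F)
    (l : literal (nexist F) (nprob F)) : bool :=
  match l.1 with inl i => A i | inr j => B j end == l.2.

Definition satisfies (F : cnf2) (A : xassign F) (B : yassign F) : bool :=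
  all (fun C : 2.-bseq _ => has (lit_true A B) C) (clauses F).

Definition nsat (F : cnf2) (A : xassign F) : nat :=
  #|[set B : yassign F | satisfies A B]|.

(* "At least 2^(n'-1)" is cleared of the denominator, so that n' = 0 is not
   affected by truncated subtraction. *)
Definition e_maj (F : cnf2) : Prop :=
  exists A : xassign F, 2 ^ nprob F <= 2 * nsat A.

Definition e_frac (R : realType) (rho : R) (F : cnf2) : Prop :=
  exists A : xassign F,
    (rho <= (nsat A)%:R / (#|{: yassign F}|)%:R :> R)%R.

(* Numbers are in unary.  As the numbers of variables are part of the instance
   in unary too, the size of an encoding is polynomially related to
   (number of variables + number of clauses). *)
Definition encode_nat (n : nat) : seq bool := rcons (nseq n true) false.

Definition encode_seq (T : Type) (enc : T -> seq bool) (s : seq T) : seq bool :=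
  rcons (flatten [seq true :: enc a | a <- s]) false.

Definition encode_literal p q (l : literal p q) : seq bool :=
  l.2 :: match l.1 with
         | inl i => true :: encode_nat i
         | inr j => false :: encode_nat j
         end.

Definition encode_cnf2 (F : cnf2) : seq bool :=
  encode_nat (nexist F) ++ encode_nat (nprob F) ++
  encode_seq (fun C : 2.-bseq _ => encode_seq (@encode_literal _ _) C)
    (clauses F).

(* Words that do not encode an instance are not in the language. *)
Definition E_MAJ_2SAT (w : seq bool) : Prop :=
  exists2 F : cnf2, w = encode_cnf2 F & e_maj F.

(* Main.v *)
(* For an assignment A to the existential variables, F(A, y) consists of the
   clauses G without existential variables and of the set T(A) of literals that A
   forces.  If a fraction rho of the y satisfies F(A, y), then T(A) has at most
   log_2(1/rho) elements, and at most log_{4/3}(1/rho) two-variable clauses of G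
   are disjoint, so that O(log(1/rho)) variables hit all of them.  The procedure
   guesses T and a hitting set U, which are n^O(log(1/rho)) candidates.  It checks
   that some A forces no literal outside T, which is a 2-SAT instance, decided by
   unit propagation, and it counts the models of G and T: after each of the
   2^|U| assignments to U only unit clauses remain, which are satisfied by a
   fraction 2^-f or by none.  As sums of at most 2^|U| powers of 1/2 cannot
   accumulate at rho from below, comparing the sum with an arbitrary real rho only
   requires finitely many cases, which the finite control of the machine holds.

   The machine has two tapes.  Its second tape has one cell per index of a
   variable; a cell holds a few marks, and tells which of the boundedly many
   pointers (the guesses and the loop counters) have this index as their value. *)
Require Import Defs.
From HB Require Import structures.
From mathcomp Require Import all_boot all_order all_algebra.
From mathcomp Require Import zify ring lra.
From mathcomp Require Import boolp reals sequences exp.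

Set Implicit Arguments.
Unset Strict Implicit.
Unset Printing Implicit Defensive.

Import Order.TTheory GRing.Theory Num.Theory.

(** The check is one-sided. For arbitrary guesses, the sum over the branches is at most the number
    of models of G and T, which is at most the number of y satisfying F(A, y) for every A that
    forces nothing outside T. So a wrong guess cannot cause a wrong acceptance, and the
    probabilistic bounds only serve to show that one guess, for which the sum is exact, is short
    enough.

    The obstacle is that correctness and running time concern an explicit transition table. Each
    program therefore has a pure meaning on words, pointer values and cell contents, and [computes]
    ties this meaning to a machine fragment with a polynomial time bound. Results of fragments are
    kept in the finite control, so their types are finite. Guessing is exhaustive search by nested
    loops; each loop costs one more factor of about the input length, so the number of pointers,
    linear in kappa, governs the exponent. *)

Definition upd (I : eqType) (T : Type) (f : I -> T) (i : I) (x : T) : I -> T :=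
  fun j => if j == i then x else f j.

Lemma upd_same (I : eqType) T (f : I -> T) i : upd f i (f i) = f.
Proof. by apply: funext => j; rewrite /upd; case: eqP => [->|]. Qed.

(** * Fragments of two-tape machines *)

Definition shift (d : move) : int :=
  match d with MoveLeft => (-1)%R | Stay => 0%R | MoveRight => 1%R end.

(* A tape as its content, indexed by absolute positions, and the position of
   the head. *)
Definition atape (S : Type) : Type := (int -> S) * int.

Definition tape_act S (a : S * move) (t : atape S) : atape S :=
  (upd t.1 t.2 a.1, (t.2 + shift a.2)%R).

Section Frag.

Variable W : finType.

Let S : finType := option (bool + W).

(* A machine fragment with result in [E]; [inr e] is a successor of a state
   when the fragment ends with result [e]. *)
Record frag (E : Type) := Frag {
  fstate : finType;
  fstart : fstate;
  fstep : fstate -> S -> S -> (fstate + E) * ((S * move) * (S * move))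
}.

Definition cfg2 : Type := atape S * atape S.

Definition read (t : atape S) : S := t.1 t.2.

Definition act2 (a : (S * move) * (S * move)) (c : cfg2) : cfg2 :=
  (tape_act a.1 c.1, tape_act a.2 c.2).

Inductive run E (m : frag E) : fstate m -> cfg2 -> nat -> E -> cfg2 -> Prop :=
| run_exit q c e a : fstep q (read c.1) (read c.2) = (inr e, a) ->
    run q c 1 e (act2 a c)
| run_step q c q' a n e c' : fstep q (read c.1) (read c.2) = (inl q', a) ->
    run q' (act2 a c) n e c' -> run q c n.+1 e c'.

Definition runs E (m : frag E) (c : cfg2) (n : nat) (e : E) (c' : cfg2) : Prop :=
  run (fstart m) c n e c'.

(** The start state does not enter the transitions, so a loop entered with one argument can be
    continued as the loop entered with another. *)
Lemma run_start E (Q : finType) q0 q1 (st : Q -> S -> S -> (Q + E) * _) q c n e c' :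
  @run E (Frag q0 st) q c n e c' -> @run E (Frag q1 st) q c n e c'.
Proof.
elim=> {q c n e c'} [q c e a E0|q c q' a n e c' E0 _]; first exact: run_exit.
exact: run_step.
Qed.

Definition fact E (a : S -> S -> E * ((S * move) * (S * move))) : frag E :=
  Frag tt (fun _ s0 s1 => (inr (a s0 s1).1, (a s0 s1).2)).

Lemma runs_act E (a : S -> S -> E * ((S * move) * (S * move))) c :
  runs (fact a) c 1 (a (read c.1) (read c.2)).1
    (act2 (a (read c.1) (read c.2)).2 c).
Proof. exact: run_exit. Qed.

(** The states of all continuations form a disjoint sum, finite because [E1] is; the result of [m]
    is thus remembered by the control. *)
Definition fbind (E1 : finType) E2 (m : frag E1) (k : E1 -> frag E2) : frag E2 :=
  @Frag E2 (fstate m + {e : E1 & fstate (k e)})%type (inl (fstart m))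
    (fun q s0 s1 => match q with
     | inl q1 => let: (r, a) := fstep q1 s0 s1 in
         (inl match r with
              | inl q1' => inl q1'
              | inr e => inr (existT (fun e => fstate (k e)) e (fstart (k e)))
              end, a)
     | inr (existT e q2) => let: (r, a) := fstep q2 s0 s1 in
         (match r with
          | inl q2' => inl (inr (existT (fun e => fstate (k e)) e q2'))
          | inr e2 => inr e2
          end, a)
     end).

Lemma runs_bind (E1 : finType) E2 (m : frag E1) (k : E1 -> frag E2)
    c n1 e1 c1 n2 e2 c2 :
  runs m c n1 e1 c1 -> runs (k e1) c1 n2 e2 c2 ->
  runs (fbind m k) c (n1 + n2) e2 c2.
Proof.
move=> r1 r2; rewrite /runs.
have r2' : @run _ (fbind m k) (inr (existT _ e1 (fstart (k e1)))) c1 n2 e2 c2.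
  elim: r2 => [q c0 e a E0|q c0 q' a n e c' E0 _ IH].
    by apply: run_exit => /=; rewrite E0.
  apply: (run_step _ IH) => /=. by rewrite E0.
rewrite /=; elim: r1 r2' {r2} => [q c0 e a E0|q c0 q' a n e c' E0 _ IH] r2.
  by rewrite add1n; apply: (run_step _ r2) => /=; rewrite E0.
by rewrite addSn; apply: (run_step _ (IH r2)) => /=; rewrite E0.
Qed.

(* [inl e] asks for another iteration, with argument [e]. *)
Definition floop (E : finType) E' (body : E -> frag (E + E')) (e0 : E) :
    frag E' :=
  @Frag E' {e : E & fstate (body e)}
    (existT (fun e => fstate (body e)) e0 (fstart (body e0)))
    (fun q s0 s1 => match q with existT e q1 =>
       let: (r, a) := fstep q1 s0 s1 in
       (match r with
        | inl q1' => inl (existT (fun e => fstate (body e)) e q1')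
        | inr (inl e') =>
            inl (existT (fun e => fstate (body e)) e' (fstart (body e')))
        | inr (inr x) => inr x
        end, a) end).

Lemma runs_loop_exit (E : finType) E' (body : E -> frag (E + E')) e0 c n x c' :
  runs (body e0) c n (inr x) c' -> runs (floop body e0) c n x c'.
Proof.
rewrite /runs /=; move: (fstart (body e0)) => q0.
move Ey: (inr x) => y r; elim: r Ey => [q c0 e a E0|q c0 q' a n1 e c1 E0 _ IH] Ey.
  by apply: run_exit => /=; rewrite E0 -Ey.
by apply: (run_step _ (IH Ey)) => /=; rewrite E0.
Qed.

Lemma runs_loop_next (E : finType) E' (body : E -> frag (E + E'))
    e0 c n e1 c1 m x c' :
  runs (body e0) c n (inl e1) c1 -> runs (floop body e1) c1 m x c' ->
  runs (floop body e0) c (n + m) x c'.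
Proof.
rewrite /runs /= => r r2; move: (fstart (body e0)) r => q0.
move Ey: (inl e1) => y r; elim: r Ey r2 => [q c0 e a E0|q c0 q' a n1 e c2 E0 _ IH] Ey r2.
  rewrite add1n; apply: (@run_step _ (floop body e0) _ _
    (existT (fun e => fstate (body e)) e1 (fstart (body e1))) a).
    by rewrite /= E0 -Ey.
  exact: run_start r2.
by rewrite addSn; apply: (run_step _ (IH Ey r2)) => /=; rewrite E0.
Qed.

(** * Simulation of fragments by Turing machines *)

Definition tape_cell (t : tape (bool + W)) (z : int) : S :=
  match z with
  | Posz 0 => scanned t
  | Posz n.+1 => nth None (rtape t) n
  | Negz n => nth None (ltape t) n
  end.

Definition represents (t : tape (bool + W)) (u : atape S) : Prop :=
  forall z, tape_cell t z = u.1 (u.2 + z)%R.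

Lemma tape_cell_act (t : tape (bool + W)) s d z :
  tape_cell (move_tape d (write_tape s t)) z =
  if (z + shift d == 0)%R then s else tape_cell t (z + shift d)%R.
Proof.
case: t => l s0 r; case: d; rewrite /shift /=.
- case: z => [[|[|n]]|n] //=.
  by rewrite addn0; case: l => //=; rewrite nth_nil.
- by rewrite addr0; case: z => [[|n]|n].
- case: z => [n|[|n]] //=.
    rewrite (_ : (n%:Z + 1)%R = n.+1); [|lia].
    case: n => [|n] /=; [by case: r|]. by rewrite addn1 nth_behead.
  by rewrite subn1.
Qed.

Lemma represents_act t u s d : represents t u ->
  represents (move_tape d (write_tape s t)) (tape_act (s, d) u).
Proof.
move=> tu z; rewrite tape_cell_act /tape_act /upd /=.
rewrite (_ : (u.2 + shift d + z == u.2)%R = (z + shift d == 0)%R).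
  by case: ifP => // _; rewrite tu -addrA (addrC z).
by rewrite -addrA -subr_eq0 addrAC subrr add0r addrC.
Qed.

Lemma represents_scanned t u : represents t u -> scanned t = read u.
Proof. by move=> /(_ 0%R); rewrite addr0. Qed.

Definition tm_of (m : frag bool) : tm :=
  @TM 1 W (fstate m + bool)%type (inl (fstart m))
    (fun q => if q is inr b then Some b else None)
    (fun q s => match q with
     | inl q1 => let: (r, a) := fstep q1 (s ord0) (s ord_max) in
         (r, [ffun i => if i == ord0 then a.1 else a.2])
     | inr b => (inr b, [ffun i => (s i, Stay)])
     end).

Definition cfg_rep (m : frag bool) (x : tm_config (tm_of m)) (c : cfg2) : Prop :=
  represents (x.2 ord0) c.1 /\ represents (x.2 ord_max) c.2.

Lemma tm_step_frag (m : frag bool) q tp c :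
  @cfg_rep m (inl q, tp) c ->
  let x := @tm_step (tm_of m) (inl q, tp) in
  x.1 = (fstep q (read c.1) (read c.2)).1 /\
  cfg_rep x (act2 (fstep q (read c.1) (read c.2)).2 c).
Proof.
move=> [/= r0 r1]; rewrite /tm_step /= !ffunE.
rewrite (represents_scanned r0) (represents_scanned r1).
case: (fstep _ _ _) => r [[s0 d0] [s1 d1]] /=; split=> //.
by split; rewrite /= !ffunE /=; apply: represents_act.
Qed.

Lemma iter_tm_step_verdict M (x : tm_config M) b n :
  tm_verdict x.1 = Some b -> iter n (@tm_step M) x = x.
Proof. by move=> xb; elim: n => //= n ->; rewrite /tm_step xb. Qed.

Lemma run_tm (m : frag bool) q c n b c' : @run _ m q c n b c' ->
  forall tp, @cfg_rep m (inl q, tp) c ->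
  (iter n (@tm_step (tm_of m)) (inl q, tp)).1 = inr b.
Proof.
elim=> [q0 c0 e a E0 tp /tm_step_frag[]|q0 c0 q' a n0 e c1 E0 _ IH tp].
  by rewrite E0 /= => ->.
move=> /tm_step_frag; rewrite E0 iterSr.
by case: (tm_step _) => q1 tp1 [/= -> rep]; apply: IH.
Qed.

Definition init_cfg (w : seq bool) : cfg2 :=
  ((fun z => if z is Posz i then nth None [seq Some (inl b) | b <- w] i else None,
    0%R),
   (fun _ => None, 0%R)).

Lemma cfg_rep_init (m : frag bool) w :
  @cfg_rep m (tm_init (tm_of m) w) (init_cfg w).
Proof.
split=> z; rewrite [X in X = _]/= !ffunE [(_ + z)%R]add0r /=.
  case: w => [|b w] /=; case: z => [[|n]|n] //=; by rewrite ?nth_nil.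
by case: z => [[|n]|n] //=; rewrite nth_nil.
Qed.

(** Halting configurations are fixed points of [tm_step], so a run of [n] steps settles every later
    time. *)
Lemma decides_runs (m : frag bool) w n b c' t (Q : Prop) :
  runs m (init_cfg w) n b c' -> n <= t -> (b <-> Q) ->
  decides_within (tm_of m) w t Q.
Proof.
move=> r nt bQ; exists b => //; rewrite /tm_result -(subnK nt) iterD.
have E := run_tm r (cfg_rep_init m w).
by rewrite (iter_tm_step_verdict (b := b)) /= E.
Qed.

End Frag.

(** * Computations with bounded pointers *)

Section Comp.

Variables (k : nat) (X : finType) (x0 : X).

Let cell : finType := (k.-tuple bool * X)%type.
Let W : finType := option cell.
Let S : finType := option (bool + W).

Definition home : S := Some (inr None).
Definition cell_sym (ps : k.-tuple bool) (x : X) : S := Some (inr (Some (ps, x))).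

Definition sym_cell (s : S) : option cell :=
  if s is Some (inr (Some c)) then Some c else None.

(* The pointers that are not in [v] are unset, whence the default value. *)
Definition ptrs (v : seq nat) (i : nat) : k.-tuple bool :=
  [tuple nth i.+1 v j == i | j < k].

Arguments ptrs : simpl never.

Definition input_cells (w : seq bool) (z : int) : S :=
  if z is Posz i then nth None [seq Some (inl b) | b <- w] i else None.

(** There is one cell more than there are input bits: a head that advances at most once per bit
    stays on the cells, and the blank after them ends a loop. *)
Definition mem_cells (w : seq bool) (v : seq nat) (A : nat -> X) (z : int) : S :=
  match z with
  | Posz i => if i <= size w then cell_sym (ptrs v i) (A i) else None
  | Negz 0 => home
  | _ => None
  end.

Definition conf w v A (i j : nat) : cfg2 W :=
  ((input_cells w, Posz i), (mem_cells w v A, Posz j)).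

Definition set_bit (l : nat) (b : bool) (ps : k.-tuple bool) : k.-tuple bool :=
  [tuple if j == l :> nat then b else tnth ps j | j < k].

Arguments set_bit : simpl never.

Lemma upd_input w i : i < size w ->
  upd (input_cells w) (Posz i) (Some (inl (nth false w i))) = input_cells w.
Proof.
move=> iw; rewrite -[RHS](upd_same _ (Posz i)); congr upd.
by rewrite /= (nth_map false).
Qed.

Lemma upd_input_end w : upd (input_cells w) (Posz (size w)) None = input_cells w.
Proof.
rewrite -[RHS](upd_same _ (Posz (size w))); congr upd.
by rewrite /= nth_default ?size_map.
Qed.

Lemma upd_mem w v A j x : j <= size w ->
  upd (mem_cells w v A) (Posz j) (cell_sym (ptrs v j) x) =
  mem_cells w v (upd A j x).
Proof.
move=> jw; apply: funext => -[i|i] //=; rewrite /upd eqE /= eqE /=.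
by case: eqP => // ->; rewrite jw.
Qed.

Lemma upd_mem_out w v A j : size w < j ->
  upd (mem_cells w v A) (Posz j) None = mem_cells w v A.
Proof.
by move=> wj; rewrite -[RHS](upd_same _ (Posz j)) /= leqNgt wj.
Qed.

Lemma ptrs_rcons v i j : 
  ptrs (rcons v i) j = if j == i then set_bit (size v) true (ptrs v j) else ptrs v j.
Proof.
apply: eq_from_tnth => l; case: eqP => ji; rewrite !tnth_mktuple ?tnth_mktuple nth_rcons.
  case: ltngtP => // lv; first by rewrite nth_default // ltnW.
  by rewrite ji eqxx.
case: ltngtP => // lv; first by rewrite nth_default // ltnW.
rewrite nth_default ?lv //; apply/eqP/eqP; lia.
Qed.

Lemma upd_mem_set w v A i : i <= size w ->
  upd (mem_cells w v A) (Posz i) (cell_sym (set_bit (size v) true (ptrs v i)) (A i)) =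
  mem_cells w (rcons v i) A.
Proof.
move=> iw; apply: funext => -[j|j] //=; rewrite /upd eqE /= eqE /= ptrs_rcons.
by case: eqP => // ->; rewrite iw.
Qed.

Lemma set_bit_ptrs v i : set_bit (size v) false (ptrs (rcons v i) i) = ptrs v i.
Proof.
apply: eq_from_tnth => l; rewrite ptrs_rcons eqxx !tnth_mktuple.
case: eqP => // ->; rewrite nth_default //; lia.
Qed.

Lemma upd_mem_clear w v A i : i <= size w ->
  upd (mem_cells w (rcons v i) A) (Posz i)
    (cell_sym (set_bit (size v) false (ptrs (rcons v i) i)) (A i)) =
  mem_cells w v A.
Proof.
move=> iw; apply: funext => -[j|j] //=.
rewrite set_bit_ptrs /upd eqE /= eqE /= ptrs_rcons.
by case: eqP => // ->; rewrite iw.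
Qed.

Definition stay (s : S) : S * move := (s, Stay).

Definition fret (E : Type) (e : E) : frag W E :=
  fact (fun s0 s1 => (e, (stay s0, stay s1))).

Lemma runs_ret E (e : E) c : runs (fret e) c 1 e c.
Proof.
have := runs_act (fun s0 s1 => (e, (stay s0, stay s1))) c.
rewrite /act2 /tape_act /= /read !upd_same !addr0.
by case: c => -[? ?] [? ?].
Qed.

Definition rewind1 : frag W unit :=
  floop (fun _ : unit => fact (fun s0 s1 =>
    if s1 == home then (inr tt, (stay s0, (s1, MoveRight)))
    else (inl tt, (stay s0, (s1, MoveLeft))))) tt.

Lemma runs_rewind1 w v A i j : runs rewind1 (conf w v A i j) (j + 2) tt (conf w v A i 0).
Proof.
elim: j => [|j IH]; rewrite ?addSn -[X in runs _ _ X]add1n.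
  apply: (@runs_loop_next _ _ _ _ _ _ 1 tt
    ((input_cells w, Posz i), (mem_cells w v A, Negz 0))).
    have := runs_act (fun s0 s1 => if s1 == home
      then (inr tt : unit + unit, (stay s0, (s1, MoveRight)))
      else (inl tt, (stay s0, (s1, MoveLeft)))) (conf w v A i 0).
    by rewrite /read /= /act2 /tape_act /= !upd_same addr0.
  apply: runs_loop_exit.
  have := runs_act (fun s0 s1 => if s1 == home
      then (inr tt : unit + unit, (stay s0, (s1, MoveRight)))
      else (inl tt, (stay s0, (s1, MoveLeft))))
     ((input_cells w, Posz i), (mem_cells w v A, Negz 0)).
  by rewrite /read /= /act2 /tape_act /= !upd_same addr0.
apply: (runs_loop_next _ IH).
have := runs_act (fun s0 s1 => if s1 == home
      then (inr tt : unit + unit, (stay s0, (s1, MoveRight)))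
      else (inl tt, (stay s0, (s1, MoveLeft)))) (conf w v A i j.+1).
rewrite /read /= /act2 /tape_act /= ifF; last by case: ifP.
by rewrite /= !upd_same addr0 (_ : (j.+1%:Z - 1)%R = j) //; lia.
Qed.

(** The first move leaves the blank after the input, where the search for the blank at position -1
    would otherwise stop at once. *)
Definition rewind0 : frag W unit :=
  fbind (fact (fun s0 s1 => (tt, ((s0, MoveLeft), stay s1)))) (fun _ =>
  floop (fun _ : unit => fact (fun s0 s1 =>
    if s0 == None then (inr tt, ((s0, MoveRight), stay s1))
    else (inl tt, ((s0, MoveLeft), stay s1)))) tt).

Lemma runs_rewind0 w v A i j : i <= size w ->
  runs rewind0 (conf w v A i j) (i + 2) tt (conf w v A 0 j).
Proof.
move=> iw; rewrite addn2 -[X in runs _ _ X]add1n.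
apply: (@runs_bind _ _ _ _ _ _ _ tt
  ((input_cells w, (i%:Z - 1)%R), (mem_cells w v A, Posz j))).
  have := runs_act (fun s0 s1 => (tt, ((s0, MoveLeft), stay s1))) (conf w v A i j).
  by rewrite /read /= /act2 /tape_act /= !upd_same addr0.
have mE c := runs_act (fun s0 s1 : S => if s0 == None
      then (inr tt : unit + unit, ((s0, MoveRight), stay s1))
      else (inl tt, ((s0, MoveLeft), stay s1))) c.
elim: i iw => [|i IH] iw.
  apply: runs_loop_exit; have := mE ((input_cells w, (0 - 1)%R), (mem_cells w v A, Posz j)).
  by rewrite /read /= /act2 /tape_act /= !upd_same addr0.
rewrite -[X in runs _ _ X]add1n; apply: runs_loop_next (IH (ltnW iw)).
have := mE (conf w v A i j).
rewrite /read /= (nth_map false) // /act2 /tape_act /= !upd_same addr0.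
rewrite upd_input // (_ : (i.+1%:Z - 1)%R = i); [exact | lia].
Qed.

Definition seek (l : nat) : frag W unit :=
  floop (fun _ : unit => fact (fun s0 s1 =>
    if (if sym_cell s1 is Some c then nth false c.1 l else false)
    then (inr tt, (stay s0, stay s1))
    else (inl tt, (stay s0, (s1, MoveRight))))) tt.

Lemma nth_ptrs v i l : l < k -> nth false (ptrs v i) l = (nth i.+1 v l == i).
Proof. by move=> lk; rewrite -[l]/(nat_of_ord (Ordinal lk)) -tnth_nth tnth_mktuple. Qed.

Lemma runs_seek w v A l i : l < k -> l < size v -> nth 0 v l <= size w ->
  runs (seek l) (conf w v A i 0) (nth 0 v l).+1 tt (conf w v A i (nth 0 v l)).
Proof.
move=> lk lv vw.
suff H d j : j + d = nth 0 v l ->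
    runs (seek l) (conf w v A i j) d.+1 tt (conf w v A i (nth 0 v l)).
  exact: H.
have mE c := runs_act (fun s0 s1 : S =>
    if (if sym_cell s1 is Some c then nth false c.1 l else false)
    then (inr tt : unit + unit, (stay s0, stay s1))
    else (inl tt, (stay s0, (s1, MoveRight)))) c.
elim: d j => [|d IH] j jd.
  rewrite addn0 in jd.
  apply: runs_loop_exit; have := mE (conf w v A i j).
  rewrite /read /= jd vw /cell_sym /= nth_ptrs // (set_nth_default 0) // eqxx /=.
  by rewrite /act2 /tape_act /= !addr0 -/(cell_sym _ _) upd_mem // !upd_same.
rewrite -[X in runs _ _ X]add1n; apply: (@runs_loop_next _ _ _ _ _ _ 1 tt (conf w v A i j.+1)).
  have jw : j <= size w by lia.
  have := mE (conf w v A i j).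
  rewrite /read /= jw /cell_sym /= nth_ptrs // (set_nth_default 0) //.
  rewrite (_ : nth _ _ _ == j = false); last by rewrite -jd; apply/negbTE/eqP; lia.
  rewrite /act2 /tape_act /= !addr0 -/(cell_sym _ _) upd_mem // !upd_same.
  by rewrite (_ : (j%:Z + 1)%R = j.+1) //; lia.
by apply: IH; lia.
Qed.

(** * Programs with a pure meaning and a time bound *)

Definition M (E : Type) : Type :=
  seq bool -> seq nat -> (nat -> X) -> E * (nat -> X).

(** Informative, so that the fragments of a family of continuations can be projected out and
    assembled. Both heads start and end at 0, which makes fragments composable. *)
Definition computes (E : Type) (l : nat) (F : M E) (c a : nat) : Type :=
  {m : frag W E | forall w v A, size v = l -> all (fun i => i <= size w) v ->
     exists2 n, n <= c * (size w + 2) ^ a &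
     runs m (conf w v A 0 0) n (F w v A).1 (conf w v (F w v A).2 0 0)}.

Definition mret (E : Type) (e : E) : M E := fun w v A => (e, A).

Definition mbind (E1 E2 : Type) (F : M E1) (G : E1 -> M E2) : M E2 :=
  fun w v A => let r := F w v A in G r.1 w v r.2.

Lemma computes_ret E l (e : E) a : computes l (mret e) 1 a.
Proof.
exists (fret e) => w v A vl vw; exists 1; last exact: runs_ret.
by rewrite mul1n expn_gt0 addn2.
Qed.

Lemma computes_bind (E1 : finType) E2 l (F : M E1) (G : E1 -> M E2) c1 c2 a :
  computes l F c1 a -> (forall e, computes l (G e) c2 a) ->
  computes l (mbind F G) (c1 + c2) a.
Proof.
move=> [m mP] GP; exists (fbind m (fun e => sval (GP e))) => w v A vl vw.
have [n1 n1le r1] := mP w v A vl vw.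
have [n2 n2le r2] := svalP (GP (F w v A).1) w v (F w v A).2 vl vw.
exists (n1 + n2); first by rewrite mulnDl leq_add.
exact: runs_bind r1 r2.
Qed.

(** Iteration over a fixed list, unrolled in the finite control without any pointer. *)
Fixpoint mfold (B E1 E : Type) (g : E -> E1 -> E) (F : B -> M E1)
    (e : E) (s : seq B) : M E :=
  if s is b :: s' then mbind (F b) (fun e1 => mfold g F (g e e1) s') else mret e.

Lemma computes_fold B (E1 : finType) E l (g : E -> E1 -> E) (F : B -> M E1) e s c a :
  (forall b, computes l (F b) c a) -> computes l (mfold g F e s) (size s * c + 1) a.
Proof.
move=> FP; elim: s e => [|b s IH] e /=; first exact: computes_ret.
by rewrite mulSn -addnA; apply: computes_bind.
Qed.

Definition mat (E : Type) (u : k.-tuple bool -> X -> E * X) : M E :=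
  fun w v A => let i := last 0 v in
    ((u (ptrs v i) (A i)).1, upd A i (u (ptrs v i) (A i)).2).

Lemma computes_at (E : finType) l (u : k.-tuple bool -> X -> E * X) (e0 : E) a :
  l < k -> computes l.+1 (mat u) 3 a.+1.
Proof.
move=> lk.
pose b (s0 s1 : S) := if sym_cell s1 is Some (ps, x)
  then ((u ps x).1, (stay s0, stay (cell_sym ps (u ps x).2)))
  else (e0, (stay s0, stay s1)).
exists (fbind (seek l) (fun _ => fbind (fact b) (fun e =>
  fbind rewind1 (fun _ => fret e)))) => w v A vl vw.
have lv : l < size v by rewrite vl.
have iw : nth 0 v l <= size w by move/allP: vw; apply; apply: mem_nth.
have E0 : last 0 v = nth 0 v l by rewrite (last_nth 0) vl.
exists ((nth 0 v l).+1 + (1 + ((nth 0 v l + 2) + 1))).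
  by rewrite expnS; have := expn_gt0 (size w + 2) a; nia.
apply: runs_bind (runs_seek _ _ lk lv iw) _.
apply: runs_bind (runs_act _ _) _.
rewrite /mat E0 /b /read /= iw /cell_sym /=.
apply: runs_bind; last exact: runs_ret.
have := runs_rewind1 w v (upd A (nth 0 v l) (u (ptrs v (nth 0 v l)) (A (nth 0 v l))).2) 0 (nth 0 v l).
rewrite {1}/conf -upd_mem // /act2 /tape_act /= upd_same !addr0 => r; exact: r.
Qed.

Definition mfor (E1 E : Type) (e0 : E) (g : E -> E1 -> E) (F : M E1) : M E :=
  fun w v A => foldl (fun s i => let r := F w (rcons v i) s.2 in (g s.1 r.1, r.2))
    (e0, A) (iota 0 (size w).+1).

(** The loop variable is bit [l] of one cell. After each pass the bit is sought, erased and set one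
    cell further right; a blank there ends the loop. The [size w + 1] passes give the extra factor,
    and [4] pays for seeking and rewinding. *)
Lemma computes_for (E1 E : finType) l (e0 : E) (g : E -> E1 -> E) (F : M E1) c a :
  l < k -> computes l.+1 F c a.+1 -> computes l (mfor e0 g F) (c + 4) a.+2.
Proof.
move=> lk [m mP].
pose setb (s0 s1 : S) : bool * ((S * move) * (S * move)) :=
  if sym_cell s1 is Some (ps, x)
  then (true, (stay s0, stay (cell_sym (set_bit l true ps) x)))
  else (false, (stay s0, stay s1)).
pose clr (s0 s1 : S) : unit * ((S * move) * (S * move)) :=
  if sym_cell s1 is Some (ps, x)
  then (tt, (stay s0, (cell_sym (set_bit l false ps) x, MoveRight)))
  else (tt, (stay s0, stay s1)).
pose body (e : E) : frag W (E + E) :=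
  fbind m (fun e1 => fbind (seek l) (fun _ => fbind (fact clr) (fun _ =>
  fbind (fact setb) (fun b : bool => if b
    then fbind rewind1 (fun _ => fret (inl (g e e1)))
    else fret (inr (g e e1)))))).
exists (fbind (fact setb) (fun _ => fbind (floop body e0) (fun e =>
  fbind rewind1 (fun _ => fret e)))) => w v A vl vw.
set n := size w.
pose step (s : E * (nat -> X)) i := let r := F w (rcons v i) s.2 in (g s.1 r.1, r.2).
have rset A' i : i <= n -> runs (fact setb) (conf w v A' 0 i) 1 true (conf w (rcons v i) A' 0 i).
  move=> iw; have := runs_act setb (conf w v A' 0 i).
  rewrite {2 3}/setb /read /= iw /cell_sym /= /act2 /tape_act /= -vl.
  by rewrite upd_mem_set // upd_same !addr0.
have loop d i e A' : i + d = n ->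
    exists2 t, t <= d.+1 * (c * (n + 2) ^ a.+1 + 2 * n + 8) &
    let s := foldl step (e, A') (iota i d.+1) in
    runs (floop body e) (conf w (rcons v i) A' 0 0) t s.1 (conf w v s.2 0 n.+1).
  elim: d i e A' => [|d IH] i e A' id.
    have iw : i <= n by lia.
    have [|| t1 t1le r1] := mP w (rcons v i) A'; rewrite ?size_rcons ?vl //.
      by rewrite all_rcons iw.
    rewrite -/n in t1le; exists (t1 + (i.+1 + (1 + (1 + 1)))).
      by rewrite mul1n; lia.
    apply: runs_loop_exit; apply: runs_bind r1 _.
    have := @runs_seek w (rcons v i) (F w (rcons v i) A').2 l 0 lk.
    rewrite size_rcons vl nth_rcons vl ltnn eqxx => /(_ (ltnSn _) iw) r2.
    apply: runs_bind r2 _; apply: runs_bind (runs_act _ _) _.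
    rewrite /clr /read /= iw /cell_sym /=.
    apply: (@runs_bind _ _ _ _ _ _ _ false (conf w v (F w (rcons v i) A').2 0 n.+1)); last exact: runs_ret.
    have := runs_act setb (conf w v (F w (rcons v i) A').2 0 n.+1).
    rewrite {2 3}/setb /read /= ltnn /act2 /tape_act /= !upd_same !addr0 -vl.
    rewrite upd_mem_clear // (_ : (i%:Z + 1)%R = n.+1); last by lia.
    by rewrite upd_mem_out.
  have iw : i <= n by lia.
  have [|| t1 t1le r1] := mP w (rcons v i) A'; rewrite ?size_rcons ?vl //.
    by rewrite all_rcons iw.
  have [|t2 t2le r3] := IH i.+1 (g e (F w (rcons v i) A').1) (F w (rcons v i) A').2; first by lia.
  rewrite -/n in t1le; exists ((t1 + (i.+1 + (1 + (1 + ((i.+1 + 2) + 1))))) + t2).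
    by rewrite [X in _ <= X]mulSn; apply: leq_add => //; lia.
  apply: runs_loop_next r3; apply: runs_bind r1 _.
  have := @runs_seek w (rcons v i) (F w (rcons v i) A').2 l 0 lk.
  rewrite size_rcons vl nth_rcons vl ltnn eqxx => /(_ (ltnSn _) iw) r2.
  apply: runs_bind r2 _; apply: runs_bind (runs_act _ _) _.
  rewrite /clr /read /= iw /cell_sym /=.
  apply: (@runs_bind _ _ _ _ _ _ _ true (conf w (rcons v i.+1) (F w (rcons v i) A').2 0 i.+1)).
    have := rset (F w (rcons v i) A').2 i.+1.
    rewrite /act2 /tape_act /= !upd_same !addr0 -vl upd_mem_clear //.
    rewrite (_ : (i%:Z + 1)%R = i.+1); last by lia.
    by apply; lia.
  apply: runs_bind; last exact: runs_ret.
  exact: runs_rewind1.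
have [|t tle r] := loop n 0 e0 A; first by [].
exists (1 + (t + ((n.+1 + 2) + 1))).
  have N0 : 0 < (n + 2) ^ a by rewrite expn_gt0 addn2.
  rewrite !expnS in tle *; set y := (n + 2) ^ a in N0 tle *.
  have : n.+1 * (c * ((n + 2) * y) + 2 * n + 8) + n + 5 <= (c + 4) * ((n + 2) * ((n + 2) * y)).
    by nia.
  lia.
apply: runs_bind (rset _ _ _) _ => //.
apply: runs_bind r _.
by apply: runs_bind; [apply: runs_rewind1 | apply: runs_ret].
Qed.

(* A pass over the input.  The second component of the result of [d] is the new
   content of the cell under the memory head, and the third one tells whether
   this head returns to cell 0 or moves right. *)
Definition scan_step (Q : Type) (d : Q -> bool -> k.-tuple bool -> X -> Q * X * bool)
    (v : seq nat) (s : Q * nat * (nat -> X)) (b : bool) : Q * nat * (nat -> X) :=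
  let: (q, j, A) := s in
  let: (q', x, hm) := d q b (ptrs v j) (A j) in
  (q', if hm then 0 else j.+1, upd A j x).

Definition mscan (Q : Type) (d : Q -> bool -> k.-tuple bool -> X -> Q * X * bool)
    (q0 : Q) : M Q :=
  fun w v A => let s := foldl (scan_step d v) (q0, 0, A) w in (s.1.1, s.2).

(** The memory head may return to cell 0 at every bit, in linear time each, whence a quadratic
    bound. *)
Lemma computes_scan (Q : finType) (d : Q -> bool -> k.-tuple bool -> X -> Q * X * bool)
    (q0 : Q) l a : computes l (mscan d q0) 4 a.+2.
Proof.
pose step q (s0 s1 : S) : option (Q * bool) * ((S * move) * (S * move)) :=
  match s0, sym_cell s1 with
  | Some (inl b), Some (ps, x) =>
      let: (q', x', hm) := d q b ps x in
      (Some (q', hm), ((s0, MoveRight),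
        (cell_sym ps x', if hm then Stay else MoveRight)))
  | _, _ => (None, (stay s0, stay s1))
  end.
pose body q : frag W (Q + Q) := fbind (fact (step q)) (fun r => match r with
  | None => fret (inr q)
  | Some (q', true) => fbind rewind1 (fun _ => fret (inl q'))
  | Some (q', false) => fret (inl q')
  end).
exists (fbind (floop body q0) (fun q => fbind rewind0 (fun _ =>
  fbind rewind1 (fun _ => fret q)))) => w v A vl vw.
set n := size w.
(* [j <= i] because the memory head advances at most one cell per input bit; this keeps it on the
   cells. *)
have loop w2 i q j A' : drop i w = w2 -> j <= i -> i <= n -> exists t j',
    let s := foldl (scan_step d v) (q, j, A') w2 in
    [/\ t <= (n - i) * (n + 4) + 2, j' <= n &
    runs (floop body q) (conf w v A' i j) t s.1.1 (conf w v s.2 n j')].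
  elim: w2 i q j A' => [|b w2 IH] i q j A' dw ji iw.
    have iE : i = n by apply/eqP; rewrite eqn_leq iw -subn_eq0 -size_drop dw.
    exists 2, j; split=> //=; first by lia.
      by rewrite -iE.
    apply: runs_loop_exit; apply: (@runs_bind _ _ _ _ _ _ 1 None); last first.
      exact: runs_ret.
    have := runs_act (step q) (conf w v A' i j).
    rewrite /read /= nth_default ?size_map ?iE // /act2 /tape_act /=.
    by rewrite -/n upd_input_end !upd_same !addr0.
  have iw' : i < n.
    by rewrite ltnNge; apply/negP => ni; move: dw; rewrite (drop_oversize ni).
  have [bE dE] : nth false w i = b /\ drop i.+1 w = w2.
    by move: dw; rewrite (drop_nth false) // => -[].
  have r0 := runs_act (step q) (conf w v A' i j).
  move: r0; rewrite {2 3}/step /read /= (nth_map false) //.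
  have jw : j <= size w by apply: leq_trans ji iw.
  rewrite jw /cell_sym bE; case Ed: (d _ _ _ _) => [[q' x'] hm] /=.
  rewrite Ed /act2 /tape_act /= -/(cell_sym _ _) upd_mem // -bE upd_input //.
  rewrite (_ : (i%:Z + 1)%R = i.+1); last by lia.
  move=> r0; have [|t [j' [tle j'n r]]] := IH i.+1 q' (if hm then 0 else j.+1) (upd A' j x') dE _ iw'.
    by case: (hm); lia.
  exists ((1 + (if hm then (j + 2) + 1 else 1)) + t), j'; split=> //.
    rewrite (_ : n - i = (n - i.+1).+1); last by lia.
    by rewrite mulSn; rewrite -/n in jw; case: (hm); lia.
  apply: runs_loop_next r; apply: runs_bind r0 _.
  case: (hm); last first.
    by rewrite (_ : (j%:Z + _)%R = j.+1) /=; [apply: runs_ret|lia].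
  by rewrite addr0; apply: runs_bind; [apply: runs_rewind1 | apply: runs_ret].
have [||| t [j' [tle jn r]]] := loop w 0 q0 0 A; rewrite ?drop0 //.
exists (t + ((n + 2) + ((j' + 2) + 1))).
  rewrite subn0 in tle; rewrite !expnS.
  have N0 : 0 < (n + 2) ^ a by rewrite expn_gt0 addn2.
  move: N0; set y := (n + 2) ^ a => N0.
  suff : n * (n + 4) + 2 + 2 * n + 5 <= 4 * ((n + 2) * ((n + 2) * y)) by lia.
  nia.
apply: runs_bind r _; apply: runs_bind; first by apply: runs_rewind0.
by apply: runs_bind; [apply: runs_rewind1 | apply: runs_ret].
Qed.

(** Beforehand the machine writes [home] at position -1 and lays out empty cells while it sweeps
    over the input and the blank after it, which yields the additional cell. The added [4] pays for
    this. *)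
Lemma computes_decides (F : M bool) c a : computes 0 F c a.+1 ->
  exists M : tm, forall w t (Q : Prop), (c + 4) * (size w + 2) ^ a.+1 <= t ->
  ((F w [::] (fun _ => x0)).1 <-> Q) -> decides_within M w t Q.
Proof.
move=> [m mP].
pose def := cell_sym [tuple false | _ < k] x0.
pose body (_ : unit) : frag W (unit + unit) := fact (fun s0 s1 =>
  if s0 == None then (inr tt, (stay s0, stay def))
  else (inl tt, ((s0, MoveRight), (def, MoveRight)))).
pose m0 : frag W bool :=
  fbind (fact (fun s0 s1 => (tt, (stay s0, (s1, MoveLeft))))) (fun _ =>
  fbind (fact (fun s0 s1 => (tt, (stay s0, (home, MoveRight))))) (fun _ =>
  fbind (floop body tt) (fun _ =>
  fbind rewind0 (fun _ => fbind rewind1 (fun _ => m))))).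
exists (tm_of m0) => w t Q tle FQ; set n := size w.
have [// | // | t1 t1le r1] := mP w [::] (fun _ => x0).
pose part i (z : int) : S := match z with
  | Posz j => if j < i then def else None
  | Negz 0 => home | _ => None end.
have updp i : upd (part i) (Posz i) def = part i.+1.
  apply: funext => -[j|j] //=; rewrite /upd eqE /= eqE /= ltnS [j <= i]leq_eqVlt.
  by case: (j == i).
have partE : part n.+1 = mem_cells w [::] (fun _ => x0).
  apply: funext => -[j|[|j]] //=; rewrite ltnS; case: ifP => // _.
  congr cell_sym; apply: eq_from_tnth => l; rewrite !tnth_mktuple nth_nil.
  by apply/esym/eqP; lia.
have loop d i : i + d = n -> runs (floop body tt)
    ((input_cells w, Posz i), (part i, Posz i)) d.+1 tt
    (conf w [::] (fun _ => x0) n n).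
  elim: d i => [|d IH] i id.
    rewrite addn0 in id; subst i; apply: runs_loop_exit.
    have := runs_act (fun s0 s1 : S =>
      if s0 == None then (inr tt : unit + unit, (stay s0, stay def))
      else (inl tt, ((s0, MoveRight), (def, MoveRight))))
      ((input_cells w, Posz n), (part n, Posz n)).
    rewrite /read /= nth_default ?size_map //= /act2 /tape_act /= !addr0.
    by rewrite updp partE upd_input_end.
  rewrite -[X in runs _ _ X]add1n.
  apply: (@runs_loop_next _ _ _ _ _ _ 1 tt
    ((input_cells w, Posz i.+1), (part i.+1, Posz i.+1))); last by apply: IH; lia.
  have iw : i < size w by rewrite -/n; lia.
  have := runs_act (fun s0 s1 : S =>
    if s0 == None then (inr tt : unit + unit, (stay s0, stay def))
    else (inl tt, ((s0, MoveRight), (def, MoveRight))))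
    ((input_cells w, Posz i), (part i, Posz i)).
  rewrite /read /= (nth_map false) //= /act2 /tape_act /= updp.
  rewrite (_ : (i%:Z + 1)%R = i.+1); last by lia.
  by rewrite upd_input.
apply: (@decides_runs _ m0 w (1 + (1 + (n.+1 + ((n + 2) + ((n + 2) + t1))))) _
  (conf w [::] (F w [::] (fun _ => x0)).2 0 0) t) FQ; last first.
  apply: leq_trans tle; rewrite mulnDl -/n.
  suff : 3 * n + 7 <= 4 * (n + 2) ^ a.+1 by move: t1le; rewrite -/n; lia.
  rewrite expnS; have N0 : 0 < (n + 2) ^ a by rewrite expn_gt0 addn2.
  by nia.
apply: (@runs_bind _ _ _ _ _ _ _ tt ((input_cells w, Posz 0), (fun _ => None, Negz 0))).
  have := runs_act (fun s0 s1 : S => (tt, (stay s0, (s1, MoveLeft)))) (init_cfg _ w).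
  by rewrite /read /= /act2 /tape_act /= !upd_same.
apply: (@runs_bind _ _ _ _ _ _ _ tt ((input_cells w, Posz 0), (part 0, Posz 0))).
  have := runs_act (fun s0 s1 : S => (tt, (stay s0, (home, MoveRight))))
    ((input_cells w, Posz 0), (fun _ => None, Negz 0)).
  rewrite /read /= /act2 /tape_act /= !upd_same.
  rewrite (_ : upd _ _ _ = part 0) //.
  by apply: funext => -[j|[|j]].
apply: runs_bind (loop n 0 (add0n _)) _.
apply: runs_bind; first exact: runs_rewind0.
by apply: runs_bind; [apply: runs_rewind1 | apply: r1].
Qed.

End Comp.

(** * Parsing an instance *)

(* What the next bit of the input is: a digit of the number of existential or
   of probabilistic variables, the mark of a new clause, the mark of a new
   literal, a sign, a kind of variable, or a digit of an index. *)
Inductive phase :=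
  InExist | InProb | AtClause | AtLit | AtSign | AtTag | InIndex | Parsed | Failed.

Definition phase_code (p : phase) : 'I_9 :=
  inord (match p with
  | InExist => 0 | InProb => 1 | AtClause => 2 | AtLit => 3 | AtSign => 4
  | AtTag => 5 | InIndex => 6 | Parsed => 7 | Failed => 8 end).

Definition phase_decode (i : 'I_9) : phase :=
  nth Failed [:: InExist; InProb; AtClause; AtLit; AtSign; AtTag; InIndex; Parsed] i.

Lemma phase_codeK : cancel phase_code phase_decode.
Proof. by case; rewrite /phase_decode /phase_code inordK. Qed.

HB.instance Definition _ := Finite.copy phase (can_type phase_codeK).

(* In the cell of index [i], the first component tells for which kinds of
   variables, existential ([true]) or probabilistic ([false]), [i] is the index
   of a variable; the second one holds a mark for each of the two literals on
   the existential variable of index [i]. *)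
Definition slot : finType := ({ffun bool -> bool} * {ffun bool -> bool})%type.

Definition slot0 : slot := ([ffun _ => false], [ffun _ => false]).

Definition set_tag (t : bool) (x : slot) : slot :=
  ([ffun u => (u == t) || x.1 u], x.2).

Definition lit_tag p q (l : literal p q) : bool :=
  if l.1 is inl _ then true else false.

Definition lit_index p q (l : literal p q) : nat :=
  match l.1 with inl i => i | inr j => j end.

Lemma encode_literalE p q (l : literal p q) :
  encode_literal l = [:: l.2, lit_tag l & encode_nat (lit_index l)].
Proof. by case: l => -[]. Qed.

Lemma encode_seq_cons T (enc : T -> seq bool) a s :
  encode_seq enc (a :: s) = true :: enc a ++ encode_seq enc s.
Proof. by rewrite /encode_seq /= rcons_cat. Qed.

Section Parser.

Variable k : nat.

(* Sign, kind of variable, and content of the memory cell of a literal. *)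
Definition lview : finType := (bool * bool * k.-tuple bool * slot)%type.

Definition pstate : finType :=
  (phase * (bool * bool) * (2.-bseq lview) * bool)%type.

(** Indices are unary, so reading one walks the memory head to its cell, whose content then joins
    the view of the literal. A clause is at most two views, hence fits in the state, and [phi] is
    evaluated by the control. With [wr], the header walk tags the cells of valid indices; these tags
    are the range check for literals. *)
Definition pstep (wr : bool) (phi : seq lview -> bool) (q : pstate) (b : bool)
    (ps : k.-tuple bool) (x : slot) : pstate * slot * bool :=
  let: (ph, st, c, fl) := q in
  match ph with
  | InExist => if b then (q, if wr then set_tag true x else x, false)
               else ((InProb, st, c, fl), x, true)
  | InProb => if b then (q, if wr then set_tag false x else x, false)
              else ((AtClause, st, c, fl), x, true)
  | AtClause => if b then ((AtLit, st, [bseq], fl), x, true)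
                else ((Parsed, st, c, fl), x, true)
  | AtLit => if b then ((AtSign, st, c, fl), x, true)
             else ((AtClause, st, c, fl || phi c), x, true)
  | AtSign => ((AtTag, (b, st.2), c, fl), x, true)
  | AtTag => ((InIndex, (st.1, b), c, fl), x, true)
  | InIndex =>
      if b then (q, x, false)
      else if x.1 st.2 && (size c < 2)
      then ((AtLit, st, insub_bseq 2 (rcons c (st.1, st.2, ps, x)), fl), x, true)
      else ((Failed, st, c, fl), x, true)
  | Parsed | Failed => ((Failed, st, c, fl), x, true)
  end.

Definition pstart : pstate := (InExist, (false, false), [bseq], false).

Definition validate : M slot bool :=
  mbind (mscan (pstep true (fun _ => false)) pstart)
        (fun q => mret (q.1.1.1 == Parsed)).

Definition scan (phi : seq lview -> bool) : M slot bool :=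
  mbind (mscan (pstep false phi) pstart) (fun q => mret q.2).

Lemma computes_validate l a : computes k l validate 5 a.+2.
Proof.
rewrite -[5]/(4 + 1); apply: computes_bind => [|q]; last exact: computes_ret.
exact: computes_scan.
Qed.

Lemma computes_pscan phi l a : computes k l (scan phi) 5 a.+2.
Proof.
rewrite -[5]/(4 + 1); apply: computes_bind => [|q]; last exact: computes_ret.
exact: computes_scan.
Qed.

Definition tags_ok (p q : nat) (A : nat -> slot) : Prop :=
  forall i, (A i).1 true = (i < p) /\ (A i).1 false = (i < q).

Definition view v A p q (l : literal p q) : lview :=
  (l.2, lit_tag l, ptrs k v (lit_index l), A (lit_index l)).

Section Run.

Variables (wr : bool) (phi : seq lview -> bool) (v : seq nat).

Let go (q : pstate) (j : nat) (A : nat -> slot) (w : seq bool) :=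
  foldl (scan_step (pstep wr phi) v) (q, j, A) w.

Lemma go_exist n st c fl j A : let A' i :=
    if wr && (j <= i < j + n) then set_tag true (A i) else A i in
  go (InExist, st, c, fl) j A (encode_nat n) = ((InProb, st, c, fl), 0, A').
Proof.
move=> A'; rewrite {}/A'; elim: n j A => [|n IH] j A.
  rewrite /go /= upd_same; congr (_, _).
  by apply: funext => i; rewrite addn0; case: wr => //=; case: ifP => //; lia.
rewrite /encode_nat /= /go /= -/(go _ _ _ _) -/(encode_nat n) IH; congr (_, _).
apply: funext => i; rewrite /upd; case: wr => /=; last by case: eqP => // ->.
case: eqP => [->|/eqP ij]; first by rewrite ltnn leqnn /= ifT //; lia.
rewrite (_ : (j <= i < j + n.+1) = (j < i < j.+1 + n)) //; lia.
Qed.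

Lemma go_prob n st c fl j A : let A' i :=
    if wr && (j <= i < j + n) then set_tag false (A i) else A i in
  go (InProb, st, c, fl) j A (encode_nat n) = ((AtClause, st, c, fl), 0, A').
Proof.
move=> A'; rewrite {}/A'; elim: n j A => [|n IH] j A.
  rewrite /go /= upd_same; congr (_, _).
  by apply: funext => i; rewrite addn0; case: wr => //=; case: ifP => //; lia.
rewrite /encode_nat /= /go /= -/(go _ _ _ _) -/(encode_nat n) IH; congr (_, _).
apply: funext => i; rewrite /upd; case: wr => /=; last by case: eqP => // ->.
case: eqP => [->|/eqP ij]; first by rewrite ltnn leqnn /= ifT //; lia.
rewrite (_ : (j <= i < j + n.+1) = (j < i < j.+1 + n)) //; lia.
Qed.

Lemma go_cat q j A w1 w2 : go q j A (w1 ++ w2) =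
  let s := go q j A w1 in go s.1.1 s.1.2 s.2 w2.
Proof. by rewrite /go foldl_cat; case: (foldl _ _ w1) => [[]]. Qed.

Lemma go_index n st c fl j A :
  go (InIndex, st, c, fl) j A (encode_nat n) =
  if (A (j + n)).1 st.2 && (size c < 2)
  then ((AtLit, st, insub_bseq 2 (rcons c (st.1, st.2, ptrs k v (j + n), A (j + n))), fl), 0, A)
  else ((Failed, st, c, fl), 0, A).
Proof.
elim: n j => [|n IH] j.
  by rewrite addn0 /go /=; case: ifP; rewrite upd_same.
rewrite /encode_nat /= /go /= -/(go _ _ _ _) -/(encode_nat n).
by rewrite upd_same IH addSnnS.
Qed.

Lemma go_literal p q (l : literal p q) st (c : 2.-bseq lview) fl A :
  tags_ok p q A -> size c < 2 ->
  exists (st' : bool * bool) (c' : 2.-bseq lview),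
  bseqval c' = rcons c (view v A l) /\
  go (AtLit, st, c, fl) 0 A (true :: encode_literal l) =
    ((AtLit, st', c', fl), 0, A).
Proof.
move=> Aok c2; exists (l.2, lit_tag l).
exists (insub_bseq 2 (rcons c (view v A l))); split.
  by rewrite /insub_bseq insubdK // -topredE /= size_rcons.
rewrite encode_literalE /go /= !upd_same -/(go _ _ _ _) go_index add0n c2 andbT.
rewrite (_ : (A (lit_index l)).1 _ = true) //=.
case: l => -[i|i] s /=; rewrite /lit_index /lit_tag /=.
  by rewrite (Aok i).1 ltn_ord.
by rewrite (Aok i).2 ltn_ord.
Qed.

Lemma go_literals p q (ls : seq (literal p q)) st (c : 2.-bseq lview) fl A :
  tags_ok p q A -> size c + size ls <= 2 ->
  exists st' (c' : 2.-bseq lview),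
  go (AtLit, st, c, fl) 0 A (encode_seq (@encode_literal p q) ls) =
    ((AtClause, st', c', fl || phi (c ++ [seq view v A l | l <- ls])), 0, A).
Proof.
move=> Aok; elim: ls st c => [|l ls IH] st c cl.
  by exists st, c; rewrite /go /= !upd_same cats0.
have [|st1 [c1 [c1E E1]]] := @go_literal p q l st c fl A Aok; first by move: cl => /=; lia.
have [|st2 [c2 E2]] := IH st1 c1; first by rewrite c1E size_rcons; move: cl => /=; lia.
exists st2, c2; rewrite encode_seq_cons -cat_cons go_cat E1 /= E2.
by rewrite c1E cat_rcons.
Qed.

Lemma go_clauses p q (cs : seq (2.-bseq (literal p q))) st (c : 2.-bseq lview) fl A :
  tags_ok p q A ->
  exists st' (c' : 2.-bseq lview),
  go (AtClause, st, c, fl) 0 A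
    (encode_seq (fun C : 2.-bseq _ => encode_seq (@encode_literal p q) C) cs) =
    ((Parsed, st', c',
      fl || has (fun C : 2.-bseq _ => phi [seq view v A l | l <- C]) cs), 0, A).
Proof.
move=> Aok; elim: cs st c fl => [|C cs IH] st c fl.
  by exists st, c; rewrite /go /= !upd_same orbF.
have [|st1 [c1 E1]] := @go_literals p q C st [bseq] fl A Aok; first exact: size_bseq.
have [st2 [c2 E2]] := IH st1 c1 (fl || phi [seq view v A l | l <- C]).
exists st2, c2; rewrite encode_seq_cons /go /= upd_same.
by rewrite -/(go _ _ _ _) go_cat E1 /= E2 orbA.
Qed.

Lemma go_failed b w st c fl j A ph : ph = Parsed \/ ph = Failed ->
  (go (ph, st, c, fl) j A (b :: w)).1.1.1.1.1 = Failed.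
Proof.
elim: w b ph j A => [|b' w IH] b ph j A phE; first by case: phE => ->.
by case: phE => ->; apply: (IH b' Failed); right.
Qed.

(* The remaining input if the parser, now in phase [ph] with [m] literals in the
   current clause and at cell [j], is to succeed. *)
Definition rest_ok p q (ph : phase) (t : bool) (m j : nat) (w : seq bool) : Prop :=
  let encs := encode_seq (fun C : 2.-bseq (literal p q) => encode_seq (@encode_literal p q) C) in
  match ph with
  | AtClause => exists cs, w = encs cs
  | AtLit => exists (ls : seq (literal p q)) cs, m + size ls <= 2 /\
      w = encode_seq (@encode_literal p q) ls ++ encs cs
  | AtSign => exists (l : literal p q) (ls : seq (literal p q)) cs, m + (size ls).+1 <= 2 /\
      w = encode_literal l ++ encode_seq (@encode_literal p q) ls ++ encs cs
  | AtTag => exists (l : literal p q) (ls : seq (literal p q)) cs, m + (size ls).+1 <= 2 /\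
      w = behead (encode_literal l) ++ encode_seq (@encode_literal p q) ls ++ encs cs
  | InIndex => exists (l : literal p q) (ls : seq (literal p q)) cs, [/\ m + (size ls).+1 <= 2,
      lit_tag l = t, j <= lit_index l &
      w = encode_nat (lit_index l - j) ++
          encode_seq (@encode_literal p q) ls ++ encs cs]
  | Parsed => w = [::]
  | _ => True
  end.

(** Soundness of the parser: the encoded object is rebuilt from the end of the word, each bit
    extending what was found for the rest. *)
Lemma rest_ok_go p q A w ph st (c : 2.-bseq lview) fl j :
  tags_ok p q A -> (ph <> InIndex -> j = 0) ->
  (go (ph, st, c, fl) j A w).1.1.1.1.1 = Parsed ->
  rest_ok p q ph st.2 (size c) j w.
Proof.
move=> Aok; elim: w ph st c fl j => [|b w IH] ph st c fl j; first by case: ph.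
case: ph; rewrite /go //= ?upd_same -?/(go _ _ _ _).
- move=> /(_ ltac:(done)) ->; case: b; rewrite upd_same -/(go _ _ _ _) => /(IH _ _ _ _ _ (fun _ => erefl)) /=.
    move=> [ls [cs [ls2 ->]]].
    have ls2' : size ls <= 2 by [].
    by exists (Bseq ls2' :: cs); rewrite encode_seq_cons.
  by move=> ->; exists [::].
- move=> /(_ ltac:(done)) ->; case: b; rewrite upd_same -/(go _ _ _ _) => /(IH _ _ _ _ _ (fun _ => erefl)) /=.
    move=> [l [ls [cs [ls2 ->]]]].
    by exists (l :: ls), cs; split=> //; rewrite encode_seq_cons cat_cons -catA.
  by move=> [cs ->]; exists [::], cs; split; rewrite ?addn0 ?size_bseq.
- move=> _ /(IH _ _ _ _ _ (fun _ => erefl)) /= [[v0 s] [ls [cs [ls2 ->]]]].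
  by exists (v0, b), ls, cs; split.
- move=> _ /(IH _ _ _ _ _ (fun _ => erefl)) /= [[v0 s] [ls [cs [ls2 <- _ ->]]]].
  exists (v0, s), ls, cs; split=> //.
  by rewrite /lit_index /lit_tag /= subn0; case: v0.
- case: b => _; rewrite ?upd_same -?/(go _ _ _ _).
    move=> /(IH _ _ _ _ _ (fun nI => False_ind _ (nI erefl))) /= [l [ls [cs [ls2 lt jl ->]]]].
    exists l, ls, cs; split=> //; first exact: ltnW.
    by rewrite -[lit_index l - j]prednK /encode_nat /= -?subnS // subn_gt0.
  case: ifP => [/andP[xt c2]|_]; rewrite /= upd_same -/(go _ _ _ _); last first.
    by case: w {IH} => [|b w] //; rewrite go_failed //; right.
  move=> /(IH _ _ _ _ _ (fun _ => erefl)) /= [ls [cs [ls2 ->]]].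
  have [l [lt lj]] : exists l : literal p q, lit_tag l = st.2 /\ lit_index l = j.
    move: xt; case: st.2; rewrite ?(Aok j).1 ?(Aok j).2 => jp.
      by exists (inl (Ordinal jp), true).
    by exists (inr (Ordinal jp), true).
  exists l, ls, cs; split=> //; last 2 first.
  - by rewrite lj.
  - by rewrite lj subnn.
  move: ls2; rewrite /insub_bseq insubdK ?size_rcons ?addSnnS //.
  by rewrite -topredE /= size_rcons.
- by case: w {IH} => [|b' w] //; rewrite go_failed //; right.
Qed.

End Run.

(** In the first case the parser never leaves the header, so acceptance excludes it. *)
Lemma header_split w :
  w = nseq (size w) true \/ exists n w', w = encode_nat n ++ w'.
Proof.
elim: w => [|b w IH]; first by left.
case: b; last by right; exists 0, w.
case: IH => [{1}->|[n [w' ->]]]; first by left.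
by right; exists n.+1, w'.
Qed.

Lemma tags_ok_header p q A : (forall i, (A i).1 = [ffun _ => false]) ->
  tags_ok p q (fun i => if true && (0 <= i < 0 + q) then set_tag false
     (if true && (0 <= i < 0 + p) then set_tag true (A i) else A i)
     else if true && (0 <= i < 0 + p) then set_tag true (A i) else A i).
Proof.
move=> A0 i; rewrite !add0n /=.
by case: (i < q); case: (i < p); rewrite ?ffunE /= ?ffunE ?A0 ?ffunE.
Qed.

Lemma validate_encode F v A : (forall i, (A i).1 = [ffun _ => false]) ->
  (validate (encode_cnf2 F) v A).1 /\
  tags_ok (nexist F) (nprob F) (validate (encode_cnf2 F) v A).2.
Proof.
move=> A0; rewrite /validate /mbind /mscan /mret /encode_cnf2 /pstart.
rewrite !foldl_cat go_exist go_prob.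
have Aok := tags_ok_header (nexist F) (nprob F) A0.
have [st [c E]] := go_clauses true (fun _ => false) v (clauses F) (false, false) [bseq] false Aok.
by rewrite E /=.
Qed.

Lemma validate_sound w v A : (forall i, (A i).1 = [ffun _ => false]) ->
  (validate w v A).1 -> exists F, w = encode_cnf2 F.
Proof.
move=> A0; rewrite /validate /mbind /mscan /mret /pstart /=.
have stuck ph n j A' : ph = InExist \/ ph = InProb ->
  (foldl (scan_step (pstep true (fun _ => false)) v)
    (ph, (false, false), [bseq], false, j, A') (nseq n true)).1.1.1.1.1 = ph.
  by move=> phE; elim: n j A' => //= n IH j A'; case: phE IH => ->; apply.
have [->|[p [w1 ->]]] := header_split w; first by rewrite stuck; [move=> /eqP | left].
rewrite foldl_cat go_exist.
have [->|[q [w2 ->]]] := header_split w1; first by rewrite stuck; [move=> /eqP | right].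
rewrite foldl_cat go_prob => /eqP H.
have Aok := tags_ok_header p q A0.
have [cs ->] := rest_ok_go Aok (fun _ => erefl) H.
by exists (@Cnf2 p q cs).
Qed.

Lemma scan_encode phi F v A : tags_ok (nexist F) (nprob F) A ->
  scan phi (encode_cnf2 F) v A =
  (has (fun C : 2.-bseq _ => phi [seq view v A l | l <- C]) (clauses F), A).
Proof.
move=> Aok; rewrite /scan /mbind /mscan /mret /encode_cnf2 /pstart.
rewrite !foldl_cat go_exist go_prob /=.
by have [st [c ->]] := go_clauses false phi v (clauses F) (false, false) [bseq] false Aok.
Qed.

End Parser.

(** * Satisfiability of 2-CNFs by unit propagation *)

Section TwoSat.

Variables (I : finType) (H : seq (seq (I * bool))).

Definition negl (l : I * bool) : I * bool := (l.1, ~~ l.2).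

(** A clause falsified by [B], such as the empty one, propagates every literal; so if there is a
    variable at all, a closed consistent set falsifies no clause. *)
Definition propagates (B : {set I * bool}) (m : I * bool) : bool :=
  has (all (fun l => (l == m) || (negl l \in B))) H.

Definition closed_lits (B : {set I * bool}) : bool :=
  [forall m, propagates B m ==> (m \in B)].

Definition consistent (B : {set I * bool}) : bool :=
  [forall i, ~~ (((i, true) \in B) && ((i, false) \in B))].

Hypothesis H2 : all (fun D => size D <= 2) H.

Lemma negl_inv l : negl (negl l) = l.
Proof. by case: l => i b; rewrite /negl negbK. Qed.

Lemma consistentP B l : consistent B -> l \in B -> negl l \in B -> False.
Proof.
move=> /forallP cB; case: l => i b; have := cB i; rewrite /negl /=.
by case: b => /= h1 h2 h3; move: h1; rewrite ?h2 ?h3.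
Qed.

Lemma closed_propagates B m D : closed_lits B -> D \in H ->
  (forall l, l \in D -> (l == m) || (negl l \in B)) -> m \in B.
Proof.
move=> /forallP/(_ m)/implyP clB DH DB; apply: clB.
by apply/hasP; exists D => //; apply/allP.
Qed.

Lemma seq2_cover (T : eqType) (D : seq T) (x y z : T) : size D <= 2 ->
  x \in D -> y \in D -> x != y -> z \in D -> (z == x) || (z == y).
Proof.
move=> D2 xD yD xy zD; have u : uniq [:: x; y] by rewrite /= inE xy.
have [|_ E] := uniq_min_size u _ D2; first by move=> t; rewrite !inE => /orP[]/eqP->.
by rewrite -E !inE in zD.
Qed.

(** If [A] falsifies a literal of a clause, closure puts the other one into [A], and the clause
    propagates nothing new. Any other clause propagates within [B]. Were the negation of the
    resulting [m] in [A], the clause would not contain [m], so [B] would falsify it and contain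
    [negl m] as well. *)
Lemma closed_extend (A B : {set I * bool}) : closed_lits A -> consistent A ->
  closed_lits B -> consistent B ->
  let A' := A :|: [set l in B | negl l \notin A] in
  closed_lits A' /\ consistent A'.
Proof.
move=> clA coA clB coB A'; split; last first.
  apply/forallP => i; apply/negP => /andP[]; rewrite !inE /negl /=.
  move=> /orP[h1|/andP[h1 h1']] /orP[h2|/andP[h2 h2']].
  - exact: (consistentP coA h1 h2).
  - by rewrite /= h1 in h2'.
  - by rewrite /= h2 in h1'.
  - exact: (consistentP coB h1 h2).
apply/forallP => m; apply/implyP => /hasP[D DH /allP DA'].
have D2 := allP H2 D DH.
have [/hasP[l lD nlA]|/hasPn noA] := boolP (has (fun l => negl l \in A) D).
  have [E|/hasP[l' l'D ll']] : (forall l', l' \in D -> l' == l) \/ has (fun l' => l' != l) D.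
    case: (boolP (has _ _)) => [|/hasPn h]; [by right|left => l' /h].
    by rewrite negbK.
    have lA : l \in A.
      by apply: (@closed_propagates A l D clA DH) => l' /E ->.
    by case: (consistentP coA lA nlA).
  have l'A : l' \in A.
    apply: (@closed_propagates A l' D clA DH) => z zD.
    have := seq2_cover D2 lD l'D _ zD; rewrite eq_sym => /(_ ll') /orP[]/eqP->.
      by rewrite nlA orbT.
    by rewrite eqxx.
  have /orP[/eqP<-|] := DA' l' l'D; first by rewrite inE l'A.
  rewrite !inE => /orP[h|/andP[_]]; first by case: (consistentP coA l'A h).
  by rewrite negl_inv l'A.
have DB l : l \in D -> (l == m) || (negl l \in B).
  move=> lD; have /orP[->//|] := DA' l lD.
  by rewrite !inE (negbTE (noA l lD)) /= => /andP[-> _]; rewrite orbT.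
have mB := closed_propagates clB DH DB.
rewrite !inE mB /=; apply/orP; right; apply/negP => nmA.
have DB' l : l \in D -> negl l \in B.
  move=> lD; have /orP[/eqP lm|//] := DB l lD.
  by have := noA l lD; rewrite lm nmA.
apply: (consistentP coB mB); apply: (@closed_propagates B (negl m) D clB DH) => l lD.
by rewrite DB' ?orbT.
Qed.

(** By [closed_extend] a maximal closed consistent set is total, hence an assignment; so the
    literals can be tested one at a time, without backtracking. [i0] excludes the empty set of
    variables, where the left side is vacuous even if there is an empty clause. *)
Lemma two_sat (i0 : I) :
  (forall i, exists s, exists B, [&& closed_lits B, consistent B & (i, s) \in B]) <->
  exists a : I -> bool, all (has (fun l => a l.1 == l.2)) H.
Proof.
split=> [ex|[a aH] i]; last first.
  exists (a i), [set l | a l.1 == l.2]; rewrite inE eqxx andbT; apply/andP; split.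
    apply/forallP => m; apply/implyP => /hasP[D DH /allP DB].
    have /hasP[l lD la] := allP aH D DH.
    have := DB l lD; rewrite !inE /= => /orP[/eqP<-//|].
    by rewrite (eqP la); case: (l.2).
  by apply/forallP => j; rewrite !inE /=; case: (a j).
pose P B := closed_lits B && consistent B.
have [s [B0 /and3P[cl0 co0 _]]] := ex i0.
have PB0 : P B0 by rewrite /P cl0 co0.
have [A /maxsetP[/andP[clA coA] maxA] _] := maxset_exists PB0.
have total i : exists s', (i, s') \in A.
  have [s' [B /and3P[clB coB iB]]] := ex i.
  have [clA' coA'] := closed_extend clA coA clB coB.
  have PA' : P (A :|: [set l in B | negl l \notin A]) by rewrite /P clA' coA'.
  have [nA|nA] := boolP (negl (i, s') \in A); first by exists (~~ s').
  by exists s'; rewrite -(maxA _ PA' (subsetUl _ _)) !inE iB nA orbT.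
exists (fun i => (i, true) \in A); apply/allP => D DH; apply/negPn/negP => nD.
have nDA l : l \in D -> negl l \in A.
  move=> lD; move/hasPn: nD => /(_ l lD); case: l lD => i [] lD /=; rewrite ?eqb_id /negl /=.
    by have [[] iA] := total i; rewrite ?iA.
  by case: ((i, true) \in A).
have allA m : m \in A.
  by apply: (closed_propagates clA DH) => l /nDA ->; rewrite orbT.
exact: (@consistentP A (i0, true) coA (allA _) (allA _)).
Qed.

End TwoSat.

(** * Counting the assignments to the probabilistic variables *)

Lemma card_agree (J : finType) (P c : pred J) :
  #|[set y : {ffun J -> bool} | [forall z, P z ==> (y z == c z)]]| =
  2 ^ (#|J| - #|P|).
Proof.
pose Fam z : pred bool := if P z then pred1 (c z) else predT.
rewrite (eq_card (B := family Fam)); last first.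
  move=> y; rewrite inE; apply/forallP/familyP => h z; have := h z; rewrite /Fam;
    by case: (P z).
rewrite card_family foldrE big_map big_enum /=.
rewrite (eq_bigr (fun z => if ~~ P z then 2 else 1)); last first.
  by move=> z _; rewrite /Fam; case: (P z); rewrite ?card1 ?card_bool.
rewrite -big_mkcond /= prod_nat_const; congr (2 ^ _).
by rewrite -(cardC P) addKn; apply: eq_card.
Qed.

Section Count.

Variables (F : cnf2) (T : bool -> nat -> bool).

Let p := nexist F.
Let q := nprob F.
Let lit := literal p q.

Definition ylit_true (y : yassign F) (l : lit) : bool :=
  if l.1 is inr j then y j == l.2 else false.

Definition xlit_true (A : xassign F) (l : lit) : bool :=
  if l.1 is inl i then A i == l.2 else false.

Definition tlit (l : lit) : bool :=
  if l.1 is inr j then T l.2 j else false.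

Definition ymodel (y : yassign F) : bool :=
  all (fun C : 2.-bseq lit => has (fun l => lit_tag l) C || has (ylit_true y) C)
    (clauses F) && [forall j : 'I_q, [forall s, T s j ==> (y j == s)]].

(** Equivalently, [A] forces only literals of [T] and falsifies no clause made of existential
    literals alone. *)
Definition xmodel (A : xassign F) : bool :=
  all (fun C : 2.-bseq lit => has (fun l => lit_tag l) C ==>
    has (xlit_true A) C || has tlit C) (clauses F).

Lemma xmodel_nsat A : xmodel A -> #|[set y | ymodel y]| <= nsat A.
Proof.
move=> /allP xA; apply/subset_leq_card/subsetP => y; rewrite !inE.
move=> /andP[/allP yG /forallP yT]; apply/allP => C CF.
have [/hasP[l lC lx]|xC] := boolP (has (fun l => lit_tag l) C).
  have := xA C CF; have -> /= : has (fun l => lit_tag l) C by apply/hasP; exists l.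
  case/orP => /hasP[l' l'C]; rewrite /xlit_true /tlit => h; apply/hasP; exists l' => //.
    by move: h; rewrite /lit_true; case: (l'.1).
  move: h; rewrite /lit_true; case: (l'.1) => // j h.
  by have /forallP/(_ l'.2)/implyP/(_ h) := yT j.
have := yG C CF; rewrite (negbTE xC) /= => /hasP[l lC h]; apply/hasP; exists l => //.
by move: h; rewrite /ylit_true /lit_true; case: (l.1).
Qed.

Variables (N : nat) (vu : seq nat).
Hypothesis qN : q <= N.
Hypothesis vuN : all (fun i => i <= N) vu.

Let K := size vu.

Section Branch.

Variable b : seq bool.

Definition branch_val (i : nat) : bool := nth false b (index i vu).

Definition falsified (l : lit) : bool :=
  [&& ~~ lit_tag l, lit_index l \in vu & branch_val (lit_index l) != l.2].

(** A clause falsified by the branch forces both signs of every [z], and so shows up as a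
    conflict. *)
Definition forces (z : nat) (s : bool) : bool :=
  has (fun C : 2.-bseq lit => all (fun l => ~~ lit_tag l &&
    ((lit_index l == z) && (l.2 == s) || falsified l)) C) (clauses F).

Definition uncovered (z : nat) : bool :=
  has (fun C : 2.-bseq lit =>
    [&& all (fun l => ~~ lit_tag l && (lit_index l \notin vu)) C,
        has (fun l => lit_index l == z) C & has (fun l => lit_index l != z) C])
  (clauses F).

(** A guessed list may repeat entries or contain indices of no variable, such as padding. Bits at
    these positions must be [false], or one assignment would be counted in several branches. *)
Definition redundant (z : nat) : bool :=
  has (fun j => [&& nth 0 vu j == z, nth false b j &
    ~~ ((z < q) && (j == index z vu))]) (iota 0 K).

Definition set_to (z : nat) (s : bool) : bool :=
  forces z s || (z < q) && (T s z || (z \in vu) && (branch_val z == s)).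

Definition conflict (z : nat) : bool :=
  [|| uncovered z, redundant z | set_to z true && set_to z false].

Definition determined (z : nat) : bool := set_to z true || set_to z false.

Definition nconflict : bool := has conflict (iota 0 N.+1).
Definition ndetermined : nat := count determined (iota 0 N.+1).

End Branch.

Definition branch_of (y : yassign F) : K.-tuple bool :=
  [tuple [exists z : 'I_q, [&& nth 0 vu j == z, j == index (nat_of_ord z) vu :> nat & y z]] | j < K].

Lemma branch_ofE y j : j < K -> nth false (branch_of y) j =
  [exists z : 'I_q, [&& nth 0 vu j == z, j == index (nat_of_ord z) vu & y z]].
Proof.
by move=> jK; rewrite -[j]/(nat_of_ord (Ordinal jK)) -tnth_nth tnth_mktuple.
Qed.

Lemma branch_val_of y (z : 'I_q) : (z : nat) \in vu ->
  branch_val (branch_of y) z = y z.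
Proof.
move=> zvu; rewrite /branch_val branch_ofE ?index_mem // nth_index //.
apply/existsP/idP => [[z' /and3P[/eqP zz' _]]|yz].
  by rewrite (_ : z' = z) //; apply/val_inj.
by exists z; rewrite !eqxx.
Qed.

Lemma ymodel_set_to y (z : 'I_q) s : ymodel y -> set_to (branch_of y) z s -> y z = s.
Proof.
move=> /andP[/allP yG /forallP yT] /orP[/hasP[C CF /allP Cz]|].
  have xC : has (fun l => lit_tag l) C = false.
    by apply/hasPn => l /Cz /andP[].
  have := yG C CF; rewrite xC /= => /hasP[l lC yl].
  have /andP[lx /orP[/andP[/eqP lz /eqP <-]|/and3P[_ lvu lb]]] := Cz l lC.
    move: yl lz lx; rewrite /ylit_true /lit_index /lit_tag; case: (l.1) => // j /eqP <- jz _.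
    by congr (y _); apply/val_inj.
  move: yl lb lvu lx; rewrite /ylit_true /lit_index /lit_tag; case: (l.1) => // j /eqP <- h jvu.
  by rewrite branch_val_of // eqxx in h.
rewrite ltn_ord /= => /orP[h|/andP[zvu /eqP <-]]; last by rewrite branch_val_of.
by have /forallP/(_ s)/implyP/(_ h)/eqP := yT z.
Qed.

(** A model obeys everything that its branch sets, and [branch_of] has no redundant bits; only a
    clause missed by [vu] remains as a cause. *)
Lemma ymodel_conflict y : ymodel y -> nconflict (branch_of y) ->
  has uncovered (iota 0 N.+1).
Proof.
move=> yM /hasP[z zN /or3P[uz|/hasP[j]|/andP[st sf]]].
- by apply/hasP; exists z.
- rewrite mem_iota add0n => /= jK /and3P[/eqP jz bj ncan].
  move: bj; rewrite branch_ofE // => /existsP[z' /and3P[/eqP jz' jE _]].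
  by move: ncan; rewrite -jz jz' ltn_ord jE.
- have [zq|qz] := ltnP z q.
    have := @ymodel_set_to y (Ordinal zq) true yM st.
    by rewrite (@ymodel_set_to y (Ordinal zq) false yM sf).
  move: st; rewrite /set_to ltnNge qz /= orbF => /hasP[C CF /allP Cz].
  move: yM => /andP[/allP yG _]; have := yG C CF.
  have -> /= : has (fun l => lit_tag l) C = false.
    by apply/hasPn => l /Cz /andP[].
  move=> /hasP[l lC yl]; have := Cz l lC.
  move: yl; rewrite /falsified /ylit_true /lit_index /lit_tag; case: (l.1) => // j /eqP <-.
  rewrite (_ : (val j == z) = false) /=; last by have := ltn_ord j; lia.
  by move=> /andP[jvu]; rewrite branch_val_of ?eqxx.
Qed.

(** A clause violated by [y] has a variable outside [vu], else the branch would falsify it. Its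
    other literal is falsified by the branch or has the same variable, as the clause is covered; so
    that variable is forced against [y]. *)
Lemma ymodel_branch (b : K.-tuple bool) (y : yassign F) : ~~ nconflict b ->
  (ymodel y && (branch_of y == b)) =
  [forall z : 'I_q, determined b z ==> (y z == set_to b z true)].
Proof.
move=> /hasPn nc; have {}nc z : z <= N -> conflict b z = false.
  by move=> zN; apply/negbTE/nc; rewrite mem_iota.
apply/andP/forallP => [[yM /eqP bE] z|yD].
  apply/implyP; rewrite -bE => /orP[] h; rewrite (ymodel_set_to yM h).
    by rewrite h.
  have := nc z (leq_trans (ltnW (ltn_ord z)) qN).
  by rewrite /conflict -bE h andbT => /norP[_ /norP[_ /negbTE->]].
have yS (z : 'I_q) s : set_to b z s -> y z = s.
  move=> h; have zN := leq_trans (ltnW (ltn_ord z)) qN.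
  have /negbT/norP[_ /norP[_ nn]] := nc z zN.
  have zd : determined b z by rewrite /determined; case: s h => ->; rewrite ?orbT.
  have /implyP/(_ zd)/eqP yz := yD z; rewrite {}yz.
  by case: s h nn => ->; rewrite ?andbT // => /negbTE.
have bv (z : 'I_q) : (z : nat) \in vu -> y z = branch_val b z.
  by move=> zvu; apply: yS; rewrite /set_to ltn_ord zvu eqxx !orbT.
split; last first.
  apply/eqP/eq_from_tnth => j; rewrite tnth_mktuple (tnth_nth false).
  set z := nth 0 vu j; have zN : z <= N by apply: (allP vuN); apply: mem_nth.
  have zvu : z \in vu by apply: mem_nth.
  have [zq|qz] := boolP ((z < q) && (j == index z vu :> nat)).
    have /andP[{}zq jz] := zq; apply/existsP/idP => [[z' /and3P[/eqP zz' _]]|bj].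
      by rewrite bv -?zz' // /branch_val -(eqP jz).
    by exists (Ordinal zq); rewrite /= eqxx jz bv //= /branch_val -(eqP jz).
  have /negbT/norP[_ /norP[/hasPn/(_ j)]] := nc z zN.
  rewrite mem_iota ltn_ord /= eqxx /= qz andbT => /(_ erefl)/negbTE-> _.
  apply/existsP => -[z' /and3P[/eqP zz' jz' _]]; move: qz.
  by rewrite zz' ltn_ord jz'.
apply/andP; split; last first.
  by apply/forallP => j; apply/forallP => s; apply/implyP => h;
    apply/eqP/yS; rewrite /set_to ltn_ord h orbT.
apply/allP => C CF; apply/norP => -[/hasPn Cy /hasPn Cf].
have ind l : l \in C -> exists2 j : 'I_q, l = (inr j, l.2) & y j != l.2.
  move=> lC; have := Cy l lC; have := Cf l lC; rewrite /ylit_true /lit_tag.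
  by case: l lC => -[i|j] s //= _ ys _; exists j.
have fals l : l \in C -> lit_index l \in vu -> falsified b l.
  move=> lC lvu; have [j lE yj] := ind l lC.
  by move: lvu yj; rewrite /falsified lE /lit_index /lit_tag /= => lvu; rewrite -bv // lvu.
have [/allP Cvu|/allPn[l0 l0C l0vu]] := boolP (all (fun l => lit_index l \in vu) C).
  (* Index 0 is examined even when there is no probabilistic variable, so it always reveals a
     falsified clause. *)
  have f s : forces b 0 s.
    apply/hasP; exists C => //; apply/allP => l lC; rewrite fals ?Cvu // orbT andbT.
    exact: Cy.
  by have := nc 0 (leq0n _); rewrite /conflict /set_to !f /= !orbT.
have [j0 l0E yj0] := ind l0 l0C.
suff f : forces b j0 l0.2.
  by move: yj0; rewrite (yS j0 l0.2) ?eqxx // /set_to f.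
apply/hasP; exists C => //; apply/allP => l lC; rewrite Cy //=.
have [lvu|lvu] := boolP (lit_index l \in vu); first by rewrite fals ?orbT.
have [j lE yj] := ind l lC.
have [jj|jj] := eqVneq j j0.
  rewrite lE /lit_index /= jj eqxx /=; move: yj yj0; rewrite jj.
  by case: (y j0); case: (l.2); case: (l0.2).
have /negbT/norP[/hasPn/(_ C CF) h _] := nc j0 (leq_trans (ltnW (ltn_ord j0)) qN).
move/negP: h; case; apply/and3P; split.
- apply/allP => l' l'C; rewrite Cy //=.
  have ll0 : l0 != l.
    by apply: contra_neq jj => E; move: lE; rewrite -E l0E => -[].
  by case/orP: (seq2_cover (size_bseq C) l0C lC ll0 l'C) => /eqP->.
- by apply/hasP; exists l0 => //; rewrite l0E /lit_index.
- by apply/hasP; exists l => //; rewrite lE /lit_index.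
Qed.

(** No probabilistic literal has an index [z >= q], so only a falsified clause forces [z], and then
    with both signs. *)
Lemma determined_small b z : ~~ nconflict b -> z <= N -> determined b z -> z < q.
Proof.
move=> /hasPn/(_ z) nc zN; rewrite mem_iota ltnS zN in nc; move: (nc erefl).
rewrite /conflict /determined /set_to; case: ltnP => //= qz; rewrite !orbF.
suff -> : forces b z true = forces b z false by rewrite andbb orbb => /norP[_ /norP[_ /negbTE->]].
apply: eq_has => C; apply: eq_all => l; have [//|lx] := boolP (lit_tag l).
rewrite (_ : (lit_index l == z) = false) //; apply/negbTE; move: lx.
by rewrite /lit_tag /lit_index; case: (l.1) => // j _; rewrite neq_ltn (leq_trans (ltn_ord j) qz).
Qed.

Lemma ndeterminedE b : ~~ nconflict b ->
  ndetermined b = #|[pred z : 'I_q | determined b z]|.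
Proof.
move=> nc; rewrite /ndetermined cardE size_filter -(count_map (fun z : 'I_q => val z) (determined b)).
rewrite -enumT val_enum_ord.
rewrite -[in iota 0 N.+1](subnKC (leqW qN)) iotaD count_cat add0n.
rewrite [X in _ + X](_ : _ = 0) ?addn0 //.
apply/eqP; rewrite -leqn0 leqNgt -has_count; apply/hasPn => z.
rewrite mem_iota (subnKC (leqW qN)) ltnS => /andP[qz zN].
by apply/negP => /(determined_small nc zN); rewrite ltnNge qz.
Qed.

Lemma card_branch (b : K.-tuple bool) : ~~ nconflict b ->
  #|[set y | ymodel y && (branch_of y == b)]| = 2 ^ (q - ndetermined b).
Proof.
move=> nc; rewrite ndeterminedE //.
have := card_agree (fun z : 'I_q => determined b z) (fun z : 'I_q => set_to b z true).
rewrite card_ord => <-; by apply: eq_card => y; rewrite !inE ymodel_branch.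
Qed.

Lemma card_ymodel_branches : #|[set y | ymodel y]| =
  \sum_(b : K.-tuple bool) #|[set y | ymodel y && (branch_of y == b)]|.
Proof.
rewrite -sum1_card (partition_big branch_of predT) //=; apply: eq_bigr => b _.
by rewrite sum1_card; apply: eq_card => y; rewrite !inE -topredE /= !inE.
Qed.

(** Valid for any list [vu]: if it misses a clause, every branch conflicts and the sum is zero. *)
Lemma card_ymodel_ge :
  \sum_(b : K.-tuple bool | ~~ nconflict b) 2 ^ (q - ndetermined b) <=
  #|[set y | ymodel y]|.
Proof.
rewrite card_ymodel_branches [X in _ <= X](bigID (fun b : K.-tuple bool => ~~ nconflict b)) /=.
rewrite -[X in X <= _]addn0 leq_add //.
by apply: leq_sum => b nc; rewrite card_branch.
Qed.

Lemma card_ymodel : ~~ has uncovered (iota 0 N.+1) ->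
  \sum_(b : K.-tuple bool | ~~ nconflict b) 2 ^ (q - ndetermined b) =
  #|[set y | ymodel y]|.
Proof.
move=> nu; rewrite card_ymodel_branches [RHS](bigID (fun b : K.-tuple bool => ~~ nconflict b)) /=.
rewrite [X in _ = _ + X]big1 ?addn0; last first.
  move=> b /negPn nc; apply/eqP; rewrite cards_eq0; apply/eqP/setP => y.
  rewrite !inE; apply/negP => /andP[yM /eqP bE].
  by move/negP: nu; apply; apply: (ymodel_conflict yM); rewrite bE.
by apply: eq_bigr => b nc; rewrite card_branch.
Qed.

End Count.

(** * Bounding the guesses *)

Section Halving.

Variable J : finType.
Implicit Types (E : pred {ffun J -> bool}) (y : {ffun J -> bool}) (U : {set J}).

Definition flip (j : J) y : {ffun J -> bool} := [ffun z => y z (+) (z == j)].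

Definition depends_on U E : Prop := forall y j, j \notin U -> E (flip j y) = E y.

Lemma flipK j : involutive (flip j).
Proof. by move=> y; apply/ffunP => z; rewrite !ffunE -addbA addbb addbF. Qed.

(** [flip j] preserves [E] and exchanges the two values of [y j]. *)
Lemma card_half U E j a : depends_on U E -> j \notin U ->
  #|E| = 2 * #|[pred y | E y && (y j == a)]|.
Proof.
move=> EU jU; rewrite -(cardID [pred y : {ffun J -> bool} | y j == a] E) mul2n -addnn.
congr (_ + _). 
rewrite -[RHS](card_image (can_inj (flipK j))); apply: eq_card => y.
apply/idP/imageP => [|[y' + ->]]; rewrite !inE /=.
  move=> /andP[ya Ey]; exists (flip j y); last by rewrite flipK.
  rewrite !inE /= (EU y j jU) [E y]Ey ffunE eqxx addbT.
  by move: ya; case: (y j); case: a.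
move=> /andP[Ey ya]; rewrite -topredE /= (EU y' j jU) Ey andbT ffunE eqxx addbT.
by rewrite (eqP ya); case: a {ya}.
Qed.

(** Given [E], the four values of [(y i, y j)] are equally likely and one of them violates the
    clause; [E1] fixes [y i], so halving applies twice. *)
Lemma card_clause U E i j a b : depends_on U E -> i \notin U -> j \notin U ->
  i != j ->
  4 * #|[pred y | E y && ((y i == a) || (y j == b))]| = 3 * #|E|.
Proof.
move=> EU iU jU ij; pose E1 := [pred y | E y && (y i == ~~ a)].
have E1U : depends_on (i |: U) E1.
  move=> y z; rewrite !inE negb_or => /andP[zi zU] /=; rewrite EU // ffunE.
  by rewrite [i == z]eq_sym (negbTE zi) addbF.
have h1 := card_half (~~ a) EU iU.
have h2 : #|E1| = 2 * #|[pred y | E1 y && (y j == ~~ b)]|.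
  by apply: (card_half _ E1U); rewrite !inE negb_or eq_sym ij.
have h3 := cardID [pred y : {ffun J -> bool} | (y i == a) || (y j == b)] E.
have h4 : #|[predI E & [pred y : {ffun J -> bool} | (y i == a) || (y j == b)]]| =
   #|[pred y | E y && ((y i == a) || (y j == b))]|.
  by apply: eq_card => y; rewrite !inE.
have h5 : #|[predD E & [pred y : {ffun J -> bool} | (y i == a) || (y j == b)]]| =
   #|[pred y | E1 y && (y j == ~~ b)]|.
  apply: eq_card => y; rewrite !inE /= negb_or; case: (y i); case: (y j);
  by case: a {h1 h2 h3 h4 E1 E1U}; case: b; rewrite ?andbT ?andbF.
rewrite -/E1 in h1; rewrite h4 h5 in h3; move: h1 h2 h3. 
move=> -> -> h; rewrite -[X in X = _]addn0 -(addnK (4 * #|[pred y | E1 y & (y j == ~~ b)]|) (_ + 0)) addn0 -mulnDr h; lia.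
Qed.

End Halving.

Section Hitting.

Variable F : cnf2.
Let p := nexist F.
Let q := nprob F.
Let lit := literal p q.

Definition lit_in (U : {set 'I_q}) (l : lit) : bool :=
  if l.1 is inr j then j \in U else false.

(* Greedily chosen pairwise disjoint clauses: their variables form [U], and [E]
   is the event that they hold. *)
Lemma hitting_set (cs : seq (2.-bseq lit)) :
  exists (U : {set 'I_q}) (m : nat) (E : pred (yassign F)),
  [/\ #|U| <= 2 * m,
      forall C l l', C \in cs -> all (fun l => ~~ lit_tag l) C ->
        l \in bseqval C -> l' \in bseqval C -> lit_index l != lit_index l' -> lit_in U l || lit_in U l',
      depends_on U E,
      forall y, all (fun C : 2.-bseq lit => has (fun l => lit_tag l) C ||
        has (ylit_true y) C) cs -> E y &
      4 ^ m * #|E| <= 3 ^ m * 2 ^ q].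
Proof.
elim: cs => [|C cs [U [m [E [Um UC UE Ecs mE]]]]].
  exists set0, 0, predT; split=> //; first by rewrite cards0.
  by rewrite !mul1n cardT -cardE card_ffun card_bool card_ord.
pose bad l l' := [&& lit_index l != lit_index l', ~~ lit_in U l & ~~ lit_in U l'].
have [Cx|Cx] := boolP (all (fun l => ~~ lit_tag l) C); last first.
  exists U, m, E; split=> // [C' l l'|y /= /andP[_]]; last exact: Ecs.
  by rewrite inE => /predU1P[->|]; [rewrite (negbTE Cx)|apply: UC].
have [|nbad] := boolP (has (fun l => has (bad l) C) C); last first.
  exists U, m, E; split=> // [C' l l'|y /= /andP[_]]; last exact: Ecs.
  rewrite inE => /predU1P[->|]; last exact: UC.
  move=> _ lC l'C ll'; have /hasPn/(_ l lC)/hasPn/(_ l' l'C) := nbad.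
  by rewrite /bad ll' /= -negb_or negbK.
move=> /hasP[l lC /hasP[l' l'C /and3P[ll' lU l'U]]].
have [j lE] : exists j, l = (inr j, l.2).
  by have := allP Cx l lC; case: (l) => -[i|j] s //; exists j.
have [j' l'E] : exists j, l' = (inr j, l'.2).
  by have := allP Cx l' l'C; case: (l') => -[i|i] s //; exists i.
have jU : j \notin U by rewrite lE in lU.
have jU' : j' \notin U by rewrite l'E in l'U.
have jj' : j != j' by move: ll'; rewrite lE l'E.
exists (j |: (j' |: U)), m.+1, [pred y | E y && ((y j == l.2) || (y j' == l'.2))].
split.
- by rewrite !cardsU1; lia.
- move=> C' k k'; rewrite inE => /predU1P[-> _ kC k'C kk'|CC C'x kC kC' kk'].
    have nll' : l != l' by apply: contra_neq ll' => ->.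
    case/orP: (seq2_cover (size_bseq C) lC l'C nll' kC) => /eqP->.
      by rewrite {1}lE /lit_in /= !inE eqxx.
    by rewrite {1}l'E /lit_in /= !inE eqxx orbT.
  have := UC C' k k' CC C'x kC kC' kk'; rewrite /lit_in.
  by case: (k.1) => [i|i]; case: (k'.1) => [i'|i'] //=; rewrite !inE;
    do ?[move=> /orP[]]; move=> ->; rewrite !orbT.
- move=> y z; rewrite !inE !negb_or => /and3P[zj zj' zU] /=; rewrite UE // !ffunE.
  by rewrite ![_ == z]eq_sym (negbTE zj) (negbTE zj') !addbF.
- move=> y /= /andP[Cy /Ecs ->] /=.
  have nll' : l != l' by apply: contra_neq ll' => ->.
  have xC : has (fun l => lit_tag l) C = false.
    by apply/hasPn => k kC; apply: (allP Cx).
  move: Cy; rewrite xC /= => /hasP[k kC yk].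
  case/orP: (seq2_cover (size_bseq C) lC l'C nll' kC) yk => /eqP->.
    by rewrite {1}lE /ylit_true /= => ->.
  by rewrite {1}l'E /ylit_true /= => ->; rewrite orbT.
- have h := card_clause l.2 l'.2 UE jU jU' jj'.
  by rewrite !expnS [4 * _]mulnC -[_ * 4 * _]mulnA h mulnCA -[3 * _ * _]mulnA leq_mul2l mE orbT.
Qed.

Lemma card_ymodel_forced (T : bool -> nat -> bool) :
  #|[set y : yassign F | ymodel T y]| <= 2 ^ (q - #|[pred j : 'I_q | T true j || T false j]|).
Proof.
have := card_agree (fun j : 'I_q => T true j || T false j) (fun j : 'I_q => T true j).
rewrite card_ord => <-; apply/subset_leq_card/subsetP => y; rewrite !inE.
move=> /andP[_ /forallP yT]; apply/forallP => z; have /forallP yz := yT z.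
apply/implyP; have := yz true; have := yz false.
by case: (T true z) => //=; case: (T false z).
Qed.

(** * Literals forced by an existential assignment *)

Definition forced_lits (A : xassign F) (s : bool) (j : nat) : bool :=
  has (fun C : 2.-bseq lit => [&& has (fun l => lit_tag l) C,
    all (fun l => ~~ xlit_true A l) C &
    has (fun l => [&& ~~ lit_tag l, lit_index l == j & l.2 == s]) C]) (clauses F).

Lemma satisfies_forced A y : satisfies A y -> ymodel (forced_lits A) y.
Proof.
move=> /allP sat; apply/andP; split.
  apply/allP => C CF; have [//|xC] := boolP (has _ C).
  have /hasP[l lC h] := sat C CF; apply/hasP; exists l => //.
  have := hasPn xC l lC; move: h; rewrite /lit_true /ylit_true /lit_tag.
  by case: (l.1).
apply/forallP => j; apply/forallP => s; apply/implyP => /hasP[C CF].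
move=> /and3P[/hasP[x xC xt] /allP Af /hasP[l lC /and3P[lt lj ls]]].
have xl : x != l by apply: contraNneq lt => <-.
have /hasP[k kC] := sat C CF.
case/orP: (seq2_cover (size_bseq C) xC lC xl kC) => /eqP->.
  have := Af x xC; move: xt; rewrite /xlit_true /lit_true /lit_tag.
  by case: (x.1) => // i _ /negbTE ->.
move: lt lj ls; rewrite /lit_true /lit_tag /lit_index; case: (l.1) => // i _ /eqP ij /eqP <-.
by rewrite (_ : i = j) //; apply/val_inj.
Qed.

(** The satisfying [y] excludes a clause falsified by [A] that has no probabilistic literal left to
    force. *)
Lemma xmodel_forced A y : satisfies A y -> xmodel (forced_lits A) A.
Proof.
move=> /allP sat; apply/allP => C CF; apply/implyP => xC; apply/orP.
have [|/hasPn nx] := boolP (has (xlit_true A) C); [by left|right].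
have /hasP[l lC h] := sat C CF; apply/hasP; exists l => //.
have := nx l lC; move: h; rewrite /lit_true /xlit_true /tlit.
case lE: (l.1) => [i|j]; first by move=> ->.
move=> _ _; apply/hasP; exists C => //; apply/and3P; split=> //.
  by apply/allP.
by apply/hasP; exists l => //; rewrite /lit_tag /lit_index lE !eqxx.
Qed.

End Hitting.

(** The number of pointers is fixed, so guesses have fixed length. The filler [q] is a legal pointer
    value but the index of no probabilistic variable. *)
Definition pad (q K : nat) (s : seq nat) : seq nat := s ++ nseq (K - size s) q.

Definition guessed (vp vn : seq nat) (s : bool) (j : nat) : bool :=
  j \in (if s then vp else vn).

Lemma eq_ymodel F T T' : (forall s j, j < nprob F -> T s j = T' s j) ->
  @ymodel F T =1 ymodel T'.
Proof.
move=> TT y; rewrite /ymodel; congr (_ && _).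
by apply: eq_forallb => j; apply: eq_forallb => s; rewrite TT.
Qed.

Lemma eq_xmodel F T T' : (forall s j, j < nprob F -> T s j = T' s j) ->
  @xmodel F T =1 xmodel T'.
Proof.
move=> TT A; apply: eq_all => C; congr (_ ==> (_ || _)).
by apply: eq_has => l; rewrite /tlit; case: (l.1) => // j; rewrite TT.
Qed.

Section Guess.

Variables (R : realType) (rho : R) (kappa N : nat) (F : cnf2).
Hypotheses (rho_gt0 : (0 < rho)%R) (rho_kappa : ((4%:R^-1) ^+ kappa < rho)%R).
Hypothesis qN : nprob F <= N.

Let q := nprob F.

Definition branch_sum (T : bool -> nat -> bool) (vu : seq nat) : nat :=
  \sum_(b : (size vu).-tuple bool | ~~ @nconflict F T N vu b)
    2 ^ (q - @ndetermined F T N vu b).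

(* As 2^-(2 kappa) < rho and (3/4)^(5 kappa) < rho, fewer than a fraction [rho]
   of the assignments satisfy more than [2 * kappa] unit clauses, or [5 * kappa]
   disjoint clauses, whose variables are [10 * kappa] in number. *)
Definition guess_ok (vp vn vu : seq nat) : Prop :=
  [/\ size vp = 2 * kappa, size vn = 2 * kappa, size vu = 10 * kappa,
      [/\ all (fun i => i <= N) vp, all (fun i => i <= N) vn &
          all (fun i => i <= N) vu] &
      (exists A, xmodel (F := F) (guessed vp vn) A) /\
      (rho * (2 ^ q)%:R <= (branch_sum (guessed vp vn) vu)%:R)%R].

Lemma pad_enum K (P : pred 'I_q) : #|P| <= K ->
  let s := pad q K [seq val j | j <- enum P] in
  [/\ size s = K, all (fun i => i <= N) s &
      forall j : 'I_q, (val j \in s) = P j].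
Proof.
move=> PK; split.
- by rewrite size_cat size_nseq size_map -cardE subnKC.
- rewrite all_cat all_nseq qN orbT andbT all_map; apply/allP => j _ /=.
  exact: leq_trans (ltnW (ltn_ord j)) qN.
- move=> j; rewrite mem_cat mem_nseq (ltn_eqF (ltn_ord j)) andbF orbF.
  by rewrite (mem_map val_inj) mem_enum.
Qed.

Lemma e_frac_guess : e_frac rho F <-> exists vp vn vu, guess_ok vp vn vu.
Proof.
have c0 : (0 < (2 ^ q)%:R :> R)%R by rewrite ltr0n expn_gt0.
have cY : #|{: yassign F}| = 2 ^ q by rewrite card_ffun card_bool card_ord.
split=> [[A hA]|[vp [vn [vu [_ _ _ [_ _ vuN] [[A xA] hb]]]]]]; last first.
  exists A; rewrite cY ler_pdivlMr //; apply: le_trans hb _; rewrite ler_nat.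
  exact: leq_trans (card_ymodel_ge _ qN vuN) (xmodel_nsat xA).
move: hA; rewrite cY ler_pdivlMr // => hA.
(* Serves both size bounds: a satisfied fraction of at most [e / d <= 4 ^ (- kappa)] would lie below
   [rho]. *)
have small s d e : nsat A <= s -> s * d <= e * 2 ^ q -> 0 < e -> e * 4 ^ kappa <= d -> False.
  move=> As sd e0 ed.
  have h1 : (rho * d%:R <= e%:R)%R.
    rewrite -(ler_pM2r c0) mulrAC -natrM; apply: le_trans (_ : (s * d)%:R <= _)%R.
      by rewrite natrM ler_pM ?mulr_ge0 ?ler0n ?(ltW rho_gt0) // (le_trans hA) ?ler_nat.
    by rewrite ler_nat.
  have h2 : (e%:R < rho * (e * 4 ^ kappa)%:R)%R.
    have -> : (e%:R = (4%:R^-1) ^+ kappa * (e * 4 ^ kappa)%:R :> R)%R.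
      by rewrite natrM natrX mulrCA -exprMn mulVf ?pnatr_eq0 // expr1n mulr1.
    by rewrite ltr_pM2r // ltr0n muln_gt0 e0 expn_gt0.
  have h3 : (rho * (e * 4 ^ kappa)%:R <= rho * d%:R)%R by rewrite ler_pM2l // ler_nat.
  by have := lt_le_trans h2 (le_trans h3 h1); rewrite ltxx.
have nsat0 : 0 < nsat A by rewrite -(ltr0n R); apply: lt_le_trans hA; rewrite mulr_gt0.
have [y0] : exists y, satisfies A y.
  by move: nsat0; rewrite card_gt0 => /set0Pn[y]; rewrite inE; exists y.
move=> y0A; pose T := forced_lits A.
have nT : nsat A <= #|[set y : yassign F | ymodel T y]|.
  by apply/subset_leq_card/subsetP => y; rewrite !inE; apply: satisfies_forced.
pose W := [pred j : 'I_q | T true j || T false j].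
have Wq : #|W| <= q by rewrite -[X in _ <= X]card_ord max_card.
have WK : #|W| <= 2 * kappa.
  rewrite leqNgt; apply/negP => KW.
  apply: (small _ (4 ^ kappa) 1 (leqnn _)) => //; last by rewrite mul1n.
  rewrite mul1n; apply: (@leq_trans (2 ^ (q - #|W|) * 2 ^ #|W|)).
    apply: leq_mul; first by apply: leq_trans nT _; apply: card_ymodel_forced.
    by rewrite (_ : 4 = 2 ^ 2) // -expnM leq_exp2l // ltnW.
  by rewrite -expnD subnK.
have [U [m [E [Um UC _ UE mE]]]] := hitting_set (clauses F).
have UK : #|U| <= 10 * kappa.
  apply: leq_trans Um _; suff : m <= 5 * kappa by lia.
  rewrite leqNgt; apply/negP => Km; apply: (small #|E| (4 ^ m) (3 ^ m)).
  - by apply/subset_leq_card/subsetP => y; rewrite !inE => /satisfies_forced/andP[/UE].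
  - by rewrite mulnC.
  - by rewrite expn_gt0.
  - have h34 k : 3 ^ k <= 4 ^ k by case: k => // k; rewrite leq_exp2r.
    (* The factor 5 is chosen for [3 ^ 5 * 4 = 972 <= 1024 = 4 ^ 5]. *)
    have h5 k : 3 ^ (5 * k) * 4 ^ k <= 4 ^ (5 * k).
      by rewrite !expnM -expnMn; case: k => // k; rewrite leq_exp2r.
    rewrite -(subnK (ltnW Km)) (expnD 3) (expnD 4) -mulnA.
    by apply: leq_mul; [exact: h34 | exact: h5].
have WT s : #|[pred j : 'I_q | T s j]| <= 2 * kappa.
  apply: leq_trans WK; apply: subset_leq_card; apply/subsetP => j; rewrite !inE.
  by case: s => ->; rewrite ?orbT.
have [sp ap mp] := pad_enum (WT true); have [sn an mn] := pad_enum (WT false).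
have [su au mu] := pad_enum UK.
set vp := pad _ _ _ in sp ap mp; set vn := pad _ _ _ in sn an mn.
set vu := pad _ _ _ in su au mu.
have gT s j : j < q -> T s j = guessed vp vn s j.
  by move=> jq; rewrite /guessed; case: s; rewrite -[j]/(val (Ordinal jq)) ?mp ?mn.
exists vp, vn, vu; split=> //; split.
  by exists A; rewrite -(eq_xmodel gT); apply: (xmodel_forced y0A).
rewrite /branch_sum card_ymodel //; last first.
  apply/hasPn => z _; apply/hasP => -[C CF /and3P[/allP Cu /hasP[l lC /eqP lz] /hasP[l' l'C l'z]]].
  have Cx : all (fun l => ~~ lit_tag l) C by apply/allP => k /Cu /andP[].
  have inU k : k \in bseqval C -> ~~ lit_in U k.
    move=> /Cu /andP[_]; rewrite /lit_in /lit_index; case: (k.1) => // j.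
    by rewrite mu.
  have := UC C l l' CF Cx lC l'C; rewrite lz eq_sym => /(_ l'z).
  by rewrite (negbTE (inU l lC)) (negbTE (inU l' l'C)).
apply: le_trans hA _; rewrite ler_nat; apply: leq_trans nT _.
by apply/eq_leq/eq_card => y; rewrite !inE (eq_ymodel gT).
Qed.

End Guess.

(** * Sums of few powers of one half *)

Definition weight (R : realType) (o : option nat) : R :=
  if o is Some j then ((2%:R^-1) ^+ j)%R else 0%R.

Definition nweight (J : nat) (o : option nat) : nat :=
  if o is Some j then (if j <= J then 2 ^ (J - j) else 0) else 0.

Section Gap.

Variable R : realType.
Local Open Scope ring_scope.

Lemma half_small (e : R) : 0 < e -> exists J : nat, (2%:R^-1) ^+ J < e.
Proof.
move=> e0; have [J hJ] : exists J : nat, e^-1 < J%:R.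
  exists (Num.truncn e^-1).+1; exact: truncnS_gt.
exists J; rewrite exprVn -[e]invrK ltf_pV2 ?posrE ?exprn_gt0 ?ltr0n ?invr_gt0 //.
by apply: lt_trans hJ _; rewrite -natrX ltr_nat ltn_expl.
Qed.

Lemma half_ge (i J : nat) : (i <= J)%N -> (2%:R^-1) ^+ J <= (2%:R^-1) ^+ i :> R.
Proof.
by move=> iJ; rewrite !exprVn lef_pV2 ?posrE ?exprn_gt0 ?ltr0n // ler_weXn2l // ler1n.
Qed.

Lemma half_gt0 (i : nat) : 0 < (2%:R^-1) ^+ i :> R.
Proof. by rewrite exprn_gt0 // invr_gt0 ltr0n. Qed.

(* By induction on the number of terms: either the last term is small compared
   to the gap below [rho] of the other ones, or it is one of finitely many
   values, which can be subtracted from [rho]. *)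
Lemma weight_gap (m : nat) (rho : R) : exists2 d : R, 0 < d &
  forall s : seq (option nat), size s = m ->
    \sum_(o <- s) weight R o < rho -> \sum_(o <- s) weight R o <= rho - d.
Proof.
elim: m rho => [|m IH] rho.
  have [rho0|rho0] := ltP 0 rho.
    exists rho => // s /size0nil -> _; by rewrite big_nil subrr.
  exists 1 => // s /size0nil ->; rewrite big_nil => h.
  by have := lt_le_trans h rho0; rewrite ltxx.
have [d d0 dP] := IH rho.
have [J hJ] : exists J : nat, (2%:R^-1) ^+ J < d / 2%:R by apply: half_small; rewrite divr_gt0.
have [d' d'0 d'P] : exists2 d' : R, 0 < d' & forall j, (j < J)%N ->
    forall s : seq (option nat), size s = m ->
    \sum_(o <- s) weight R o < rho - (2%:R^-1) ^+ j ->
    \sum_(o <- s) weight R o <= rho - (2%:R^-1) ^+ j - d'.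
  elim: (J) => [|J' [d' d'0 d'P]]; first by exists 1.
  have [d2 d20 d2P] := IH (rho - (2%:R^-1) ^+ J').
  exists (Num.min d' d2) => [|j]; first by rewrite lt_min d'0.
  rewrite ltnS leq_eqVlt => /predU1P[->|jJ] s sm h.
    by apply: le_trans (d2P s sm h) _; rewrite lerB // ge_min lexx orbT.
  by apply: le_trans (d'P j jJ s sm h) _; rewrite lerB // ge_min lexx.
exists (Num.min (d / 2%:R) d') => [|[//|o s] [sm]].
  by rewrite lt_min d'0 divr_gt0.
rewrite big_cons; set S := \sum_(_ <- _) _ => h.
have hd : Num.min (d / 2%:R) d' <= d / 2%:R by rewrite ge_min lexx.
have hd' : Num.min (d / 2%:R) d' <= d' by rewrite ge_min lexx orbT.
case: o h => [j|] /= h; last first.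
  by have := dP s sm; rewrite -/S => /(_ _)-h1; have : S <= rho - d; [apply: h1; lra|lra].
have w0 := half_gt0 j.
have [jJ|Jj] := ltnP j J.
  have : S <= rho - (2%:R^-1) ^+ j - d' by apply: d'P => //; rewrite -/S; lra.
  by lra.
have wJ := half_ge Jj.
have : S <= rho - d by apply: dP => //; rewrite -/S; lra.
by lra.
Qed.

(** Dropping the terms below [2 ^ (- J)] loses at most [m * 2 ^ (- J)], less than the gap [d]. A
    truncated sum below [rho] is at most [rho - d], so the full sum is then below [rho] too. *)
Lemma nweight_truncate (m : nat) (rho : R) : exists J : nat,
  forall s : seq (option nat), size s = m ->
    (rho <= \sum_(o <- s) weight R o) =
    (rho * (2 ^ J)%:R <= (\sum_(o <- s) nweight J o)%N%:R).
Proof.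
have [d d0 dP] := weight_gap m rho.
have [J hJ] : exists J : nat, (2%:R^-1) ^+ J < d / (m.+1)%:R.
  by apply: half_small; rewrite divr_gt0 ?ltr0n.
have c0 : 0 < (2 ^ J)%:R :> R by rewrite ltr0n expn_gt0.
exists J => s sm.
pose cut (o : option nat) := if o is Some j then (if (j <= J)%N then Some j else None) else None.
have cutE : (\sum_(o <- s) nweight J o)%N%:R = (\sum_(o <- map cut s) weight R o) * (2 ^ J)%:R.
  rewrite big_map natr_sum mulr_suml; apply: eq_bigr => -[j|] _ /=; last by rewrite mul0r.
  case: leqP => jJ /=; last by rewrite mul0r.
  rewrite -[in RHS](subnKC jJ) expnD natrM mulrA (natrX _ 2 j) -exprMn mulVf ?pnatr_eq0 //.
  by rewrite expr1n mul1r.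
rewrite cutE ler_pM2r //; apply/idP/idP => h; last first.
  apply: le_trans h _; rewrite big_map; apply: ler_sum => -[j|] _ //=.
  by case: leqP => //= _; rewrite ltW ?half_gt0.
rewrite leNgt; apply/negP => h'.
have := dP _ _ h'; rewrite size_map => /(_ sm) h2.
have h3 : \sum_(o <- s) weight R o <= \sum_(o <- map cut s) weight R o + m%:R * (2%:R^-1) ^+ J.
  rewrite -sm; elim: (s) => [|o s' IH]; first by rewrite !big_nil mul0r addr0.
  rewrite !big_cons /= -natr1 mulrDl mul1r.
  have : weight R o <= weight R (cut o) + (2%:R^-1) ^+ J.
    case: o => [j|] /=; last by rewrite add0r ltW ?half_gt0.
    case: leqP => jJ /=; first by rewrite lerDl ltW ?half_gt0.
    by rewrite add0r half_ge // ltnW.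
  by lra.
have h4 : m%:R * (2%:R^-1) ^+ J < d.
  apply: (@le_lt_trans _ _ ((m%:R) * (d / (m.+1)%:R))).
    by rewrite ler_wpM2l // ltW.
  rewrite mulrCA gtr_pMr // ltr_pdivrMr ?ltr0n // mul1r ltr_nat.
  by [].
lra.
Qed.

End Gap.

(** * The decision procedure *)

Definition segment (T : Type) (o n : nat) (s : seq T) : seq T := take n (drop o s).

Section Program.

(* Pointers 0, ..., [K1 - 1] hold the guessed positive literals, the next [K1]
   ones the negated literals, and the next [K2] ones the hitting set.  Pointer
   [K] is the variable under consideration; pointers [K + 1] and [K + 2] count
   the rounds of propagation and hold the literal to be propagated. *)
Variables (K1 K2 J : nat).

Let K := K1 + K1 + K2.
Let k := K + 3.

Definition in_lits (ps : seq bool) (s : bool) : bool :=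
  true \in segment (if s then 0 else K1) K1 ps.

Definition hits (ps : seq bool) : seq bool := segment (K1 + K1) K2 ps.

Definition hit_val (b ps : seq bool) : bool := nth false b (index true (hits ps)).

Definition phi_forces (b : seq bool) (s : bool) (C : seq (lview k)) : bool :=
  all (fun u : lview k => let: (s', t, ps, x) := u in ~~ t &&
    (nth false ps K && (s' == s) || (true \in hits ps) && (hit_val b ps != s'))) C.

Definition phi_uncovered (C : seq (lview k)) : bool :=
  [&& all (fun u : lview k => let: (s', t, ps, x) := u in
        ~~ t && (true \notin hits ps)) C,
      has (fun u : lview k => nth false u.1.2 K) C &
      has (fun u : lview k => ~~ nth false u.1.2 K) C].

(** A probabilistic literal counts as false unless it is guessed, in which case its clause holds and
    propagates nothing. *)
Definition phi_propagates (s : bool) (C : seq (lview k)) : bool :=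
  has (fun u : lview k => u.1.1.2) C &&
  all (fun u : lview k => let: (s', t, ps, x) := u in
    if t then nth false ps (K + 2) && (s' == s) || x.2 (~~ s')
    else ~~ in_lits ps s') C.

Definition examine (b : seq bool) : M slot (bool * bool) :=
  mbind (scan (phi_forces b true)) (fun ft =>
  mbind (scan (phi_forces b false)) (fun ff =>
  mbind (scan phi_uncovered) (fun un =>
  mat (fun (ps : k.-tuple bool) (x : slot) =>
    let st s f := f || x.1 false &&
      (in_lits ps s || (true \in hits ps) && (hit_val b ps == s)) in
    let rd := has (fun j => [&& nth false (hits ps) j, nth false b j &
      ~~ (x.1 false && (j == index true (hits ps)))]) (iota 0 K2) in
    (([|| un, rd | st true ft && st false ff], st true ft || st false ff), x))))).

(** A count above [J] can be merged with a conflict, as [nweight J] vanishes on both; so the counter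
    is finite. *)
Definition count_step (o : option 'I_J.+1) (r : bool * bool) : option 'I_J.+1 :=
  if o is Some c then
    if r.1 then None
    else if r.2 then (if c < J then Some (inord c.+1) else None) else Some c
  else None.

Definition branch (b : seq bool) : M slot (option 'I_J.+1) :=
  mfor (Some ord0) count_step (examine b).

Definition count_branches (dec : {ffun K2.-tuple bool -> option 'I_J.+1} -> bool) :
    M slot bool :=
  mbind (mfold (fun (e : {ffun K2.-tuple bool -> option 'I_J.+1})
                  (r : K2.-tuple bool * option 'I_J.+1) =>
                  [ffun b => if b == r.1 then r.2 else e b])
           (fun b : K2.-tuple bool => mbind (branch b) (fun o => mret (b, o)))
           [ffun _ => None] (enum {: K2.-tuple bool}))
    (fun e => mret (dec e)).

Definition set_mark (s : bool) (x : slot) : slot :=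
  (x.1, [ffun u => (u == s) || x.2 u]).

Definition propagate (s : bool) : M slot unit :=
  mbind (scan (phi_propagates s)) (fun f =>
  mat (fun (ps : k.-tuple bool) (x : slot) => (tt, if f then set_mark s x else x))).

Definition mdo (F : M slot unit) : M slot unit := mfor tt (fun _ _ => tt) F.

Definition propagation_round : M slot unit :=
  mdo (mbind (propagate true) (fun _ => propagate false)).

(** One call of [mdo] makes one round per cell. Two calls suffice: there are two literals per cell,
    and each round before closure marks a new one. *)
Definition contradictory (s : bool) : M slot bool :=
  mbind (mdo (mat (fun (ps : k.-tuple bool) (x : slot) => (tt, (x.1, [ffun _ => false]))))) (fun _ =>
  mbind (mat (fun (ps : k.-tuple bool) (x : slot) => (tt, set_mark s x))) (fun _ =>
  mbind (mdo propagation_round) (fun _ =>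
  mbind (mdo propagation_round) (fun _ =>
  mfor false orb (mat (fun (ps : k.-tuple bool) (x : slot) => (x.2 true && x.2 false, x))))))).

Definition satisfiable : M slot bool :=
  mfor true (fun e r => e && ~~ r)
    (mbind (contradictory true) (fun c1 => mbind (contradictory false) (fun c2 =>
     mret (c1 && c2)))).

Fixpoint guess (n : nat) (F : M slot bool) : M slot bool :=
  if n is n'.+1 then mfor false orb (guess n' F) else F.

Definition procedure dec : M slot bool :=
  mbind (validate k) (fun ok =>
  mbind (guess K (mbind satisfiable (fun a =>
                  mbind (count_branches dec) (fun c => mret (a && c))))) (fun r =>
  mret (ok && r))).

(** The exponent: a scan is quadratic, the loops over variable, round and literal in [satisfiable]
    add three, and the guesses add [K]. *)
Lemma computes_procedure dec :
  computes k 0 (procedure dec) (23 * 2 ^ K2 + 4 * K + 144) (K + 5).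
Proof.
have at_ (E : finType) (e0 : E) l (u : k.-tuple bool -> slot -> E * slot) a :
    l < k -> computes k l.+1 (mat u) 3 a.+1 by exact: (computes_at u e0).
have prop s : computes k K.+3 (propagate s) (5 + 3) 2.
  apply: computes_bind => [|f]; first exact: computes_pscan.
  by apply: (at_ _ tt); rewrite /k; lia.
have rounds : computes k K.+1 (mdo propagation_round) 24 4.
  rewrite -[24]/(20 + 4); apply: computes_for; first by rewrite /k; lia.
  rewrite -[20]/(16 + 4); apply: computes_for; first by rewrite /k; lia.
  by rewrite -[16]/(8 + 8); apply: computes_bind => [|_]; apply: prop.
have contra s : computes k K.+1 (contradictory s) 65 4.
  rewrite -[65]/(7 + (3 + (24 + (24 + 7)))).
  apply: computes_bind => [|_].
    by rewrite -[7]/(3 + 4); apply: computes_for; [rewrite /k; lia|apply: (at_ _ tt); rewrite /k; lia].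
  apply: computes_bind => [|_]; first by apply: (at_ _ tt); rewrite /k; lia.
  apply: computes_bind => [|_]; first exact: rounds.
  apply: computes_bind => [|_]; first exact: rounds.
  by rewrite -[7]/(3 + 4); apply: computes_for; [rewrite /k; lia|apply: (at_ _ true); rewrite /k; lia].
have sat : computes k K satisfiable 135 5.
  rewrite -[135]/(131 + 4); apply: computes_for; first by rewrite /k; lia.
  rewrite -[131]/(65 + (65 + 1)); apply: computes_bind => [|c1]; first exact: contra.
  by apply: computes_bind => [|c2]; [apply: contra|apply: computes_ret].
have exam b : computes k K.+1 (examine b) 18 4.
  rewrite -[18]/(5 + (5 + (5 + 3))).
  do 3![apply: computes_bind => [|?]; first exact: computes_pscan].
  by apply: (at_ _ (true, true)); rewrite /k; lia.
have count : computes k K (count_branches dec) ((2 ^ K2 * 23 + 1) + 1) 5.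
  apply: computes_bind => [|e]; last exact: computes_ret.
  have -> : 2 ^ K2 = size (enum {: K2.-tuple bool}).
    by rewrite -cardT card_tuple card_bool.
  apply: computes_fold => b; rewrite -[23]/(22 + 1).
  apply: computes_bind => [|o]; last exact: computes_ret.
  by rewrite -[22]/(18 + 4); apply: computes_for; [rewrite /k; lia|apply: exam].
have gs n l (F : M slot bool) c a : l + n <= K -> computes k (l + n) F c a.+1 ->
    computes k l (guess n F) (c + 4 * n) (a.+1 + n).
  elim: n l => [|n IH] l ln cF /=; first by rewrite muln0 !addn0 -[l]addn0.
  rewrite mulnS [4 + _]addnC addnA (addSn a) (addnS a).
  apply: computes_for; first by rewrite /k; lia.
  rewrite -addSn; apply: IH; first by lia.
  by rewrite addSnnS.
have lf : computes k (0 + K) (mbind satisfiable (fun a =>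
                  mbind (count_branches dec) (fun c => mret (a && c))))
      (135 + ((2 ^ K2 * 23 + 1) + 1 + 1)) 5.
  apply: computes_bind => [|?]; first exact: sat.
  by apply: computes_bind => [|?]; [apply: count|apply: computes_ret].
have -> : 23 * 2 ^ K2 + 4 * K + 144 = 5 + (135 + ((2 ^ K2 * 23 + 1) + 1 + 1) + 4 * K + 1).
  by lia.
apply: computes_bind => [|ok].
  by rewrite -[K + 5]/(K + 3.+2) addnS addnS; apply: computes_validate.
apply: computes_bind => [|r]; last exact: computes_ret.
by rewrite (addnC K 5); apply: (gs K 0).
Qed.

End Program.

(** * Correctness of the procedure *)

Lemma segment_ptrs k v i o n : o + n <= size v -> o + n <= k ->
  segment o n (ptrs k v i) = [seq x == i | x <- segment o n v].
Proof.
move=> onv onk; have sv : size (segment o n v) = n.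
  by rewrite /segment size_takel // size_drop; lia.
have sp : size (segment o n (ptrs k v i)) = n.
  by rewrite /segment size_takel // size_drop size_tuple; lia.
apply: (@eq_from_nth _ false) => [|j]; first by rewrite size_map sv sp.
rewrite sp => jn; rewrite (nth_map i.+1) ?sv // /segment !nth_take // !nth_drop.
by rewrite nth_ptrs //; lia.
Qed.

Lemma mem_map_eq (s : seq nat) i : (true \in [seq x == i | x <- s]) = (i \in s).
Proof. by elim: s => //= x s IH; rewrite !inE IH eq_sym eqb_id eq_sym; congr (_ || _); rewrite eq_sym. Qed.

Lemma index_map_eq (s : seq nat) i : index true [seq x == i | x <- s] = index i s.
Proof. by elim: s => //= x s ->; rewrite eqb_id. Qed.

Lemma mfor_inv (X : finType) (E1 E : Type) (Inv : nat -> E -> (nat -> X) -> Prop)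
    (e0 : E) (g : E -> E1 -> E) (F : M X E1) w v A :
  Inv 0 e0 A ->
  (forall i e A', i <= size w -> Inv i e A' ->
     Inv i.+1 (g e (F w (rcons v i) A').1) (F w (rcons v i) A').2) ->
  Inv (size w).+1 (mfor e0 g F w v A).1 (mfor e0 g F w v A).2.
Proof.
move=> I0 IS; rewrite /mfor.
suff H n i s : i + n = (size w).+1 -> Inv i s.1 s.2 ->
    let r := foldl (fun s i => let r := F w (rcons v i) s.2 in (g s.1 r.1, r.2))
      s (iota i n) in Inv (size w).+1 r.1 r.2 by exact: (H _ 0 (e0, A)).
elim: n i s => [|n IH] i s; first by rewrite addn0 => -> .
by move=> iE Is /=; apply: IH; [lia|apply: IS => //; lia].
Qed.

Lemma size_encode F : nexist F + nprob F < size (encode_cnf2 F).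
Proof. by rewrite /encode_cnf2 !size_cat !size_rcons !size_nseq; lia. Qed.

Section Correctness.

Variables (K1 K2 J : nat) (F : cnf2) (vp vn vu : seq nat).
Hypotheses (svp : size vp = K1) (svn : size vn = K1) (svu : size vu = K2).

Let K := K1 + K1 + K2.
Let k := K + 3.
Let w := encode_cnf2 F.
Let N := size w.
Let T := guessed vp vn.
Let vK := vp ++ vn ++ vu.

Let ok (A : nat -> slot) : Prop := tags_ok (nexist F) (nprob F) A.

Lemma size_vK : size vK = K.
Proof. by rewrite /vK !size_cat svp svn svu addnA. Qed.

Lemma in_litsE rest i s : in_lits K1 (ptrs k (vK ++ rest) i) s = T s i.
Proof.
have sK := size_vK; rewrite /in_lits segment_ptrs; last 2 first.
- by rewrite size_cat sK /K; case: s; lia.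
- by rewrite /k /K; case: s; lia.
rewrite mem_map_eq /T /guessed /segment /vK -!catA; case: s.
  by rewrite drop0 take_size_cat.
by rewrite drop_size_cat ?take_size_cat.
Qed.

Lemma hitsE rest i : hits K1 K2 (ptrs k (vK ++ rest) i) = [seq x == i | x <- vu].
Proof.
have sK := size_vK; rewrite /hits segment_ptrs; last 2 first.
- by rewrite size_cat sK /K; lia.
- by rewrite /k /K; lia.
rewrite /segment /vK -!catA catA drop_size_cat ?size_cat ?svp ?svn //.
by rewrite take_size_cat.
Qed.

Lemma nth_pointer rest z i : nth false (ptrs k (vK ++ z :: rest) i) K = (z == i).
Proof.
rewrite nth_ptrs ?/k; last by lia.
by rewrite nth_cat size_vK ltnn subnn.
Qed.

Lemma nth_pointer2 r0 r1 z i : nth false (ptrs k (vK ++ [:: r0; r1; z]) i) (K + 2) = (z == i).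
Proof.
rewrite nth_ptrs ?/k; last by lia.
by rewrite nth_cat size_vK ltnNge leq_addr /= addKn.
Qed.

Lemma has_phi_forces b s z A :
  has (fun C : 2.-bseq _ => @phi_forces K1 K2 b s
     [seq view k (vK ++ [:: z]) A l | l <- C]) (clauses F) = forces F vu b z s.
Proof.
apply: eq_has => C; rewrite /phi_forces all_map; apply: eq_all => l /=.
rewrite nth_pointer hitsE mem_map_eq /falsified /branch_val /hit_val hitsE index_map_eq.
by rewrite eq_sym; case: (lit_tag l).
Qed.

Lemma has_phi_uncovered z A :
  has (fun C : 2.-bseq _ => @phi_uncovered K1 K2
     [seq view k (vK ++ [:: z]) A l | l <- C]) (clauses F) = uncovered F vu z.
Proof.
apply: eq_has => C; rewrite /phi_uncovered all_map !has_map; congr [&& _, _ & _].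
- by apply: eq_all => l /=; rewrite hitsE mem_map_eq.
- by apply: eq_has => l /=; rewrite nth_pointer eq_sym.
- by apply: eq_has => l /=; rewrite nth_pointer eq_sym.
Qed.

Lemma examineE b z A : ok A -> size b = K2 ->
  examine K1 K2 b w (rcons vK z) A = ((conflict F T vu b z, determined F T vu b z), A).
Proof.
move=> Aok sb; rewrite /examine /mbind -cats1.
rewrite !(scan_encode _ _ Aok) /= !has_phi_forces has_phi_uncovered.
rewrite /mat last_cat /=; congr (_, _); last exact: upd_same.
rewrite !in_litsE hitsE /hit_val hitsE index_map_eq mem_map_eq (Aok z).2.
rewrite -/(branch_val vu b z) -!/(set_to F T vu b z _) /conflict /determined.
congr (_, _); congr [|| _, _ | _]; rewrite /redundant svu.
apply: eq_in_has => j; rewrite mem_iota /= add0n => jK.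
by rewrite (nth_map 0) ?svu.
Qed.

Definition branch_value (b : seq bool) : option nat :=
  if nconflict F T N vu b || (J < ndetermined F T N vu b) then None
  else Some (ndetermined F T N vu b).

Lemma branchE b A : ok A -> size b = K2 ->
  (omap val (branch K1 K2 J b w vK A).1, (branch K1 K2 J b w vK A).2) =
  (branch_value b, A).
Proof.
move=> Aok sb; rewrite /branch.
pose Inv i (e : option 'I_J.+1) (A' : nat -> slot) := A' = A /\
  omap val e = if has (conflict F T vu b) (iota 0 i) || (J < count (determined F T vu b) (iota 0 i))
    then None else Some (count (determined F T vu b) (iota 0 i)).
have [|i e A' _ [-> IHe]|-> ->] := @mfor_inv _ _ _ Inv (Some ord0) (@count_step J) (examine K1 K2 b) w vK A; last by [].
  by split.
rewrite examineE //=; split=> //.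
have -> : iota 0 i.+1 = iota 0 i ++ [:: i] by rewrite -addn1 iotaD.
rewrite has_cat count_cat /= orbF addn0.
case: e IHe => [c|] /=; last first.
  by case: has => //=; case: ltnP => // h _; rewrite orbC ltn_addr.
case: has => //=; case: ltnP => //= cJ [cE]; rewrite -cE in cJ *.
case: (conflict _ _ _ _ _) => //=; case: (determined _ _ _ _ _) => /=; last first.
  by rewrite addn0 ltnNge cJ.
rewrite addn1 ltnS; case: (ltnP c J) => //= h.
by rewrite inordK.
Qed.

Lemma count_branchesE dec A : ok A ->
  count_branches K1 dec w vK A =
  (dec [ffun b : K2.-tuple bool => (branch K1 K2 J b w vK A).1], A).
Proof.
move=> Aok.
pose g (e : {ffun K2.-tuple bool -> option 'I_J.+1})
  (r : K2.-tuple bool * option 'I_J.+1) :=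
  [ffun b => if b == r.1 then r.2 else e b].
pose G (b : K2.-tuple bool) := mbind (branch K1 K2 J b) (fun o => mret (b, o)).
suff H s e : mfold g G e s w vK A =
   ([ffun b => if b \in s then (branch K1 K2 J b w vK A).1 else e b], A).
  rewrite /count_branches {1}/mbind (H (enum {: K2.-tuple bool})) /=.
  by congr (dec _, _); apply/ffunP => b; rewrite !ffunE mem_enum.
elim: s e => [|b s IH] e /=; first by congr (_, _); apply/ffunP => b; rewrite ffunE.
rewrite /mbind /G /= /mbind /mret /=.
have := branchE Aok (size_tuple b) => -[_ ->]; rewrite IH; congr (_, _).
apply/ffunP => b'; rewrite !ffunE inE; case: (b' \in s); rewrite ?orbT // orbF.
by case: eqP => // ->.
Qed.

(** * Unit propagation on the memory cells *)

Let I : finType := 'I_N.+1.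

Definition xpart (C : seq (literal (nexist F) (nprob F))) : seq (I * bool) :=
  pmap (fun l : literal (nexist F) (nprob F) =>
    if l.1 is inl i then Some (inord i : I, l.2) else None) C.

(** What is left for the existential variables when exactly the probabilistic literals in [T] count
    as true. *)
Definition residual : seq (seq (I * bool)) :=
  [seq xpart C | C : 2.-bseq (literal (nexist F) (nprob F)) <- clauses F &
     has (fun l => lit_tag l) C && ~~ has (tlit T (F := F)) C].

Definition marks (A : nat -> slot) : {set I * bool} :=
  [set m | (A (nat_of_ord m.1)).2 m.2].

Lemma has_phi_propagates s r0 r1 z A : z <= N ->
  has (fun C : 2.-bseq _ => @phi_propagates K1 K2 s
     [seq view k (vK ++ [:: r0; r1; z]) A l | l <- C]) (clauses F) =
  propagates residual (marks A) (inord z, s).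
Proof.
move=> zN; rewrite /propagates /residual.
have E (C : 2.-bseq (literal (nexist F) (nprob F))) :
    @phi_propagates K1 K2 s [seq view k (vK ++ [:: r0; r1; z]) A l | l <- C] =
    [&& has (fun l => lit_tag l) C, ~~ has (tlit T (F := F)) C &
      all (fun l => (l == (inord z, s)) || (negl l \in marks A)) (xpart C)].
  rewrite /phi_propagates has_map all_map; congr (_ && _).
  have -> (f : pred (I * bool)) : all f (xpart C) =
      all (fun l : literal (nexist F) (nprob F) => if l.1 is inl i then f (inord i, l.2) else true) C.
    by rewrite /xpart; elim: (bseqval C) => //= -[[i|i] s'] c /= ->.
  rewrite -all_predC -all_predI; apply: eq_all => -[[i|i] s'] /=; last first.
    by rewrite andbT /tlit /= in_litsE.
  have iN : i < N.+1.
    by have := ltn_ord i; have := size_encode F; rewrite -/w -/N; lia.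
  rewrite nth_pointer2 /view /lit_index /= /negl inE /= inordK //.
  by rewrite xpair_eqE -val_eqE /= !inordK // eq_sym.
elim: (clauses F) => //= C cs ->; rewrite E.
by case: (has (fun l => lit_tag l) C) => //=; case: (has (tlit T (F := F)) C).
Qed.

Lemma marks_set (A : nat -> slot) s (z : nat) : z <= N ->
  marks (upd A z (set_mark s (A z))) = (inord z, s) |: marks A.
Proof.
move=> zN; apply/setP => -[i u]; rewrite !inE /upd xpair_eqE -val_eqE /= inordK //.
by case: eqP => // ->; rewrite ffunE.
Qed.

Lemma propagateE s r0 r1 z A : ok A -> z <= N ->
  let A' := (propagate K1 K2 s w (rcons (rcons (rcons vK r0) r1) z) A).2 in
  ok A' /\ marks A' = (if propagates residual (marks A) (inord z, s)
                       then (inord z, s) |: marks A else marks A).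
Proof.
move=> Aok zN.
have -> : rcons (rcons (rcons vK r0) r1) z = vK ++ [:: r0; r1; z].
  by rewrite -!cats1 -!catA.
rewrite /propagate /mbind (scan_encode _ _ Aok) has_phi_propagates // /mat last_cat /=.
case: ifP => _; last by rewrite upd_same.
split; last exact: marks_set.
by move=> i; rewrite /upd; case: eqP => [->|_]; apply: Aok.
Qed.

(** Staying inside every closed superset of the initial marks, together with closedness at the end,
    identifies the least closed set, whatever the order of propagation. *)
Definition reaches (A A' : nat -> slot) : Prop :=
  [/\ ok A', marks A \subset marks A' &
      forall D, closed_lits residual D -> marks A \subset D -> marks A' \subset D].

Lemma reaches_trans A1 A2 A3 : reaches A1 A2 -> reaches A2 A3 -> reaches A1 A3.
Proof.
move=> [_ s12 c12] [ok3 s23 c23]; split=> //; first exact: subset_trans s12 s23.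
by move=> D clD AD; apply: c23 => //; apply: c12.
Qed.

Lemma propagate_reaches s r0 r1 z A : ok A -> z <= N ->
  let A' := (propagate K1 K2 s w (rcons (rcons (rcons vK r0) r1) z) A).2 in
  reaches A A' /\ (propagates residual (marks A) (inord z, s) -> (inord z, s) \in marks A').
Proof.
move=> Aok zN A'; have [ok' E] := propagateE s r0 r1 Aok zN.
rewrite -/A' in ok' E; rewrite /reaches E.
case: ifP => pr; split=> //; last by rewrite !inE eqxx.
split=> //; first exact: subsetUr.
move=> D /forallP/(_ (inord z, s))/implyP clD AD; rewrite subUset AD andbT sub1set.
apply: clD; move: pr => /hasP[c cH /allP cA]; apply/hasP; exists c => //.
apply/allP => l lc; case/orP: (cA l lc) => [->//|h].
by rewrite (subsetP AD _ h) orbT.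
Qed.

(** Marks set in a round influence its later tests; but if the round changes nothing, all tests were
    made against the initial marks, and they cover every literal. *)
Lemma propagation_roundP r0 r1 A : ok A ->
  let A' := (propagation_round K1 K2 w (rcons (rcons vK r0) r1) A).2 in
  reaches A A' /\ (marks A' = marks A -> closed_lits residual (marks A)).
Proof.
move=> Aok A'.
pose Inv i (_ : unit) A1 := reaches A A1 /\ (marks A1 = marks A ->
  forall m : I * bool, m.1 < i -> propagates residual (marks A) m -> m \in marks A).
have [||r cl] := @mfor_inv _ _ _ Inv tt (fun _ _ => tt)
  (mbind (propagate K1 K2 true) (fun _ => propagate K1 K2 false)) w (rcons (rcons vK r0) r1) A.
- by split.
- move=> i _ A1 iN [r1' cl1]; rewrite /mbind /=.
  have [ok1 s1 _] := r1'.
  have [r2 p2] := propagate_reaches true r0 r1 ok1 iN.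
  set A2 := (propagate _ _ _ _ _ _).2 in r2 p2 *.
  have [ok2 s2 _] := r2.
  have [r3 p3] := propagate_reaches false r0 r1 ok2 iN.
  set A3 := (propagate _ _ _ _ _ _).2 in r3 p3 *.
  have [ok3 s3 _] := r3.
  split; first exact: reaches_trans r1' (reaches_trans r2 r3).
  move=> E3 [j s] /= ji pm.
  have E2 : marks A2 = marks A.
    by apply/eqP; rewrite eqEsubset -{1}E3 s3 (subset_trans s1 s2).
  have E1 : marks A1 = marks A.
    by apply/eqP; rewrite eqEsubset -{1}E2 s2 s1.
  move: ji; rewrite ltnS leq_eqVlt => /predU1P[ji|ji]; last exact: (cl1 E1 (j, s)).
  have jE : j = inord i by apply/val_inj; rewrite /= inordK.
  by rewrite jE in pm *; case: s pm => pm; [rewrite -E2; apply: p2; rewrite E1|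
    rewrite -E3; apply: p3; rewrite E2].
split=> // E; apply/forallP => m; apply/implyP; apply: cl => //.
Qed.

Lemma roundsP o n A : ok A -> closed_lits residual (marks A) || (n <= #|marks A|) ->
  let A' := (mdo (propagation_round K1 K2) w (rcons vK o) A).2 in
  reaches A A' /\ (closed_lits residual (marks A') || (n + N.+1 <= #|marks A'|)).
Proof.
move=> Aok h A'.
pose Inv i (_ : unit) A1 := reaches A A1 /\
  (closed_lits residual (marks A1) || (n + i <= #|marks A1|)).
apply: (@mfor_inv _ _ _ Inv tt (fun _ _ => tt) (propagation_round K1 K2) w (rcons vK o) A).
  by split; rewrite ?addn0.
move=> i _ A1 iN [r1 cl1]; have [ok1 _ _] := r1.
have [r2 cl2] := propagation_roundP o i ok1.
set A2 := (propagation_round _ _ _ _ _).2 in r2 cl2 *.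
split; first exact: reaches_trans r1 r2.
have [_ s12 c12] := r2.
have [E|NE] := eqVneq (marks A2) (marks A1); first by rewrite E cl2.
have pr : marks A1 \proper marks A2 by rewrite properEneq eq_sym NE.
case/orP: cl1 => [cl1|le1].
  by move: NE; rewrite eqEsubset s12 c12.
by rewrite addnS (leq_trans _ (proper_card pr)) ?orbT.
Qed.

Definition refuted (o : nat) (s : bool) : bool :=
  ~~ [exists B : {set I * bool},
      [&& closed_lits residual B, consistent B & (inord o, s) \in B]].

Lemma contradictoryE o s A : ok A -> o <= N ->
  let r := contradictory K1 K2 s w (rcons vK o) A in
  r.1 = refuted o s /\ ok r.2.
Proof.
move=> Aok oN; rewrite /contradictory /mbind /=.
set A1 := (mdo _ w (rcons vK o) A).2.
have [ok1 m1] : ok A1 /\ forall j, j < N.+1 -> (A1 j).2 = [ffun _ => false].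
  pose Inv i (_ : unit) A1 := ok A1 /\ forall j, j < i -> (A1 j).2 = [ffun _ => false].
  apply: (@mfor_inv _ _ _ Inv tt); first by split.
  move=> i _ A' iN [ok' m']; rewrite /mat last_rcons /=; split.
    by move=> j; rewrite /upd; case: eqP => [->|_]; apply: ok'.
  move=> j; rewrite /upd ltnS leq_eqVlt; case: eqP => //= _; exact: m'.
rewrite /mat last_rcons /=; set A2 := upd A1 o _.
have ok2 : ok A2 by move=> j; rewrite /A2 /upd; case: eqP => [->|_]; apply: ok1.
have M2 : marks A2 = [set (inord o, s)].
  rewrite /A2 marks_set //; apply/setP => m; rewrite !inE m1 ?ltn_ord // ffunE.
  by rewrite orbF.
have [|r3 c3] := @roundsP o 1 A2 ok2; first by rewrite M2 cards1 orbT.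
set A3 := (mdo _ _ _ A2).2 in r3 c3 *; have [ok3 s3 l3] := r3.
have [r4 c4] := @roundsP o (1 + N.+1) A3 ok3 c3.
set A4 := (mdo _ _ _ A3).2 in r4 c4 *.
have [ok4 s4 l4] := reaches_trans r3 r4.
(* Otherwise there would be [1 + 2 * N.+1] marks, one more than there are literals. *)
have cl4 : closed_lits residual (marks A4).
  move: c4; case/orP => // c4; have := max_card (marks A4).
  by rewrite card_prod card_bool card_ord; move: c4; lia.
pose Inv i (e : bool) A' := A' = A4 /\
  e = has (fun j => (A4 j).2 true && (A4 j).2 false) (iota 0 i).
have [||E4 ->] := @mfor_inv _ _ _ Inv false orb
  (mat (fun (ps : k.-tuple bool) (x : slot) => (x.2 true && x.2 false, x))) w (rcons vK o) A4.
- by split.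
- move=> i e A' iN [-> ->]; rewrite /mat last_rcons /=; split; first exact: upd_same.
   have -> : iota 0 i.+1 = iota 0 i ++ [:: i] by rewrite -addn1 iotaD.
  by rewrite has_cat /= orbF.
rewrite E4; split=> //; rewrite /refuted.
have -> : [exists B : {set I * bool}, [&& closed_lits residual B, consistent B &
    (inord o, s) \in B]] = consistent (marks A4).
  apply/existsP/idP => [[B /and3P[clB coB oB]]|co4]; last first.
    by exists (marks A4); rewrite cl4 co4 (subsetP s4) // M2 inE.
  have sB : marks A4 \subset B by apply: l4 => //; rewrite M2 sub1set.
  apply/forallP => i; apply: contra (forallP coB i) => /andP[h1 h2].
  by rewrite !(subsetP sB).
rewrite /consistent negb_forall; apply/hasP/existsP => [[j]|[i]]; rewrite ?negbK.
  rewrite mem_iota add0n => /= jN h; exists (Ordinal jN).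
  by rewrite negbK !inE.
by rewrite !inE => h; exists (nat_of_ord i) => //; rewrite mem_iota ltn_ord.
Qed.

Lemma residual2 : all (fun D => size D <= 2) residual.
Proof.
apply/allP => D /mapP[C _ ->]; apply: leq_trans (size_bseq C).
by rewrite size_pmap count_size.
Qed.

Lemma residual_xmodel :
  (exists a : I -> bool, all (has (fun l => a l.1 == l.2)) residual) <->
  (exists A, xmodel (F := F) T A).
Proof.
have iN (i : 'I_(nexist F)) : i < N.+1.
  by have := ltn_ord i; have := size_encode F; rewrite -/w -/N; lia.
have xpartE (a : I -> bool) (C : 2.-bseq _) : has (fun l => a l.1 == l.2) (xpart C) =
    has (xlit_true [ffun i : 'I_(nexist F) => a (inord i)]) C.
  by rewrite /xpart; elim: (bseqval C) => //= -[[i|i] s] c /= ->; rewrite /xlit_true /= ?ffunE.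
split=> [[a /allP aH]|[A /allP xA]].
  exists [ffun i : 'I_(nexist F) => a (inord i)]; apply/allP => C CF; apply/implyP => xC.
  have [|nT] := boolP (has (tlit T (F := F)) C); first by rewrite orbT.
  rewrite orbF -xpartE; apply: aH; apply/mapP; exists C => //.
  by rewrite mem_filter xC nT.
pose a (i : I) := if insub (nat_of_ord i) is Some i' then A i' else false.
exists a; apply/allP => D /mapP[C]; rewrite mem_filter => /andP[/andP[xC nT] CF] ->.
rewrite xpartE; have := xA C CF; rewrite xC (negbTE nT) orbF /=.
congr (is_true _); apply: eq_has => l; rewrite /xlit_true; case: (l.1) => // i.
rewrite ffunE /a inordK //; congr (_ == _).
by case: insubP => [i' _ ii'|]; [congr (A _); apply/val_inj|rewrite ltn_ord].
Qed.

Lemma satisfiableE A : ok A ->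
  let r := satisfiable K1 K2 w vK A in
  (r.1 <-> exists A, xmodel (F := F) T A) /\ ok r.2.
Proof.
move=> Aok r.
pose Inv i (e : bool) A' := ok A' /\
  e = all (fun o => ~~ (refuted o true && refuted o false)) (iota 0 i).
have [||ok' rE] := @mfor_inv _ _ _ Inv true (fun e r => e && ~~ r)
  (mbind (contradictory K1 K2 true) (fun c1 => mbind (contradictory K1 K2 false) (fun c2 =>
     mret (c1 && c2)))) w vK A.
- by split.
- move=> i e A' iN [ok' ->]; rewrite /mbind /mret /=.
  have [-> ok1] := contradictoryE true ok' iN.
  have [-> ok2] := contradictoryE false ok1 iN.
  split=> //; have -> : iota 0 i.+1 = iota 0 i ++ [:: i] by rewrite -addn1 iotaD.
  by rewrite all_cat /= andbT.
split=> //; rewrite -residual_xmodel -(two_sat residual2 (ord0 : I)) rE.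
split=> [/allP h i|h]; last first.
  apply/allP => o; rewrite mem_iota add0n => /= oN.
  have [s [B hB]] := h (Ordinal oN); rewrite negb_and /refuted !negbK.
  have oE : inord o = Ordinal oN by apply/val_inj; rewrite /= inordK.
  by case: s hB => hB; apply/orP; [left|right]; apply/existsP; exists B; rewrite oE.
have := h i; rewrite mem_iota ltn_ord => /(_ erefl).
rewrite negb_and /refuted !negbK inord_val => /orP[] /existsP[B hB].
  by exists true, B.
by exists false, B.
Qed.

End Correctness.

(* [dec] compares the sum over the branches with the threshold, truncated to
   [J] binary digits so that it only depends on finitely many values. *)
Definition threshold (R : realType) (rho : R) (K2 J : nat)
    (e : {ffun K2.-tuple bool -> option 'I_J.+1}) : bool :=
  (rho * (2 ^ J)%:R <= (\sum_b nweight J (omap val (e b)))%N%:R)%R.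

Lemma thresholdE (R : realType) (rho : R) (K1 K2 J : nat) F vp vn vu A :
  size vp = K1 -> size vn = K1 -> size vu = K2 ->
  (forall s : seq (option nat), size s = 2 ^ K2 ->
    (rho <= \sum_(o <- s) weight R o)%R =
    (rho * (2 ^ J)%:R <= (\sum_(o <- s) nweight J o)%N%:R)%R) ->
  tags_ok (nexist F) (nprob F) A ->
  (count_branches K1 (@threshold R rho K2 J) (encode_cnf2 F) (vp ++ vn ++ vu) A).1 =
  (rho * (2 ^ nprob F)%:R <=
   (branch_sum (size (encode_cnf2 F)) F (guessed vp vn) vu)%:R)%R.
Proof.
move=> svp svn svu hJ Aok; set w := encode_cnf2 F; rewrite count_branchesE //=.
set N := size w; set T := guessed vp vn; subst K2.
pose bv b := if nconflict F T N vu b then None else Some (ndetermined F T N vu b).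
have := hJ [seq bv (tval b) | b <- enum {: (size vu).-tuple bool}].
rewrite size_map -cardT card_tuple card_bool => /(_ erefl).
rewrite 2!big_map 2!big_enum /=; set S := (\sum_ _ _)%R => E.
have -> : threshold rho [ffun b : (size vu).-tuple bool =>
    (branch K1 (size vu) J b w (vp ++ vn ++ vu) A).1] = (rho <= S)%R.
  rewrite E /threshold; congr (_ <= _%:R)%R; apply: eq_bigr => b _; rewrite ffunE.
  have /(congr1 fst) /= -> := branchE J svp svn erefl Aok (size_tuple b).
  rewrite /branch_value /bv -/w -/N -/T; case: nconflict => //=.
  by rewrite ltnNge; case E1: (_ <= J) => //=; rewrite E1.
have c0 : (0 < (2 ^ nprob F)%:R :> R)%R by rewrite ltr0n expn_gt0.
have qN : nprob F <= N by have := size_encode F; rewrite -/w -/N; lia.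
(* Scaling by [2 ^ nprob F] turns the weight [2 ^ (- d)] of a branch into its number of models. *)
rewrite -(ler_pM2r c0); congr (_ <= _)%R.
rewrite /branch_sum natr_sum mulr_suml [RHS]big_mkcond /=; apply: eq_bigr => b _.
rewrite /bv; have [|nc] := boolP (nconflict F T N vu b); first by rewrite mul0r.
have dq : ndetermined F T N vu b <= nprob F.
  by rewrite (ndeterminedE qN nc) -[X in _ <= X]card_ord max_card.
rewrite /= -[in LHS](subnKC dq) expnD natrM mulrA (natrX _ 2 (ndetermined _ _ _ _ _)).
by rewrite -exprMn mulVf ?pnatr_eq0 // expr1n mul1r.
Qed.

Lemma guessP K F (L : M slot bool) (P : seq nat -> Prop) n v A :
  let w := encode_cnf2 F in
  (forall v A, size v = K -> tags_ok (nexist F) (nprob F) A ->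
    ((L w v A).1 <-> P v) /\ tags_ok (nexist F) (nprob F) (L w v A).2) ->
  size v + n = K -> tags_ok (nexist F) (nprob F) A ->
  ((guess n L w v A).1 <->
    exists u, [/\ size u = n, all (fun i => i <= size w) u & P (v ++ u)]) /\
  tags_ok (nexist F) (nprob F) (guess n L w v A).2.
Proof.
move=> w LP; elim: n v A => [|n IH] v A vn Aok /=.
  have [|LE Lok] := LP v A _ Aok; first by rewrite -vn addn0.
  split=> //; rewrite LE; split=> [Pv|[u [/size0nil-> _]]]; last by rewrite cats0.
  by exists [::]; rewrite cats0.
pose Q i := exists u, [/\ size u = n, all (fun i => i <= size w) u & P (rcons v i ++ u)].
pose Inv i (e : bool) A' := tags_ok (nexist F) (nprob F) A' /\
  (e <-> exists2 j, j < i & Q j).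
have [||ok' rE] := @mfor_inv _ _ _ Inv false orb (guess n L) w v A.
- by split=> //; split=> // -[].
- move=> i e A' iN [ok' eE].
  have [|gE gok] := IH (rcons v i) A' _ ok'; first by rewrite size_rcons addSnnS.
  split=> //; split=> [/orP[/eE[j ji Qj]|/gE Qi]|[j]].
  + by exists j => //; apply: ltnW.
  + by exists i.
  + rewrite ltnS leq_eqVlt => /predU1P[->|ji] Qj; apply/orP.
      by right; apply/gE.
    by left; apply/eE; exists j.
split=> //; rewrite rE; split=> [[j jw [u [su au Pu]]]|[u [su au Pu]]].
  by exists (j :: u); rewrite /= su -cat_rcons; split=> //; rewrite -ltnS jw.
case: u su au Pu => // j u [su] /andP[jw au] Pu.
by exists j => //; exists u; rewrite cat_rcons.
Qed.

Section Procedure.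

Variables (R : realType) (rho : R) (kappa J : nat).
Hypotheses (rho_gt0 : (0 < rho)%R) (rho_kappa : ((4%:R^-1) ^+ kappa < rho)%R).
Hypothesis hJ : forall s : seq (option nat), size s = 2 ^ (10 * kappa) ->
  (rho <= \sum_(o <- s) weight R o)%R =
  (rho * (2 ^ J)%:R <= (\sum_(o <- s) nweight J o)%N%:R)%R.

Let K1 := 2 * kappa.
Let K2 := 10 * kappa.
Let K := K1 + K1 + K2.

Definition decide : M slot bool := procedure K1 (@threshold R rho K2 J).

Lemma decide_encode F : (decide (encode_cnf2 F) [::] (fun _ => slot0)).1 <-> e_frac rho F.
Proof.
have [v1 Aok] := @validate_encode (K + 3) F [::] (fun _ => slot0) (fun _ => erefl).
set w := encode_cnf2 F in v1 Aok *.
set A1 := (validate _ _ _ _).2 in Aok.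
pose L := mbind (satisfiable K1 K2) (fun a =>
  mbind (count_branches K1 (@threshold R rho K2 J)) (fun c => mret (a && c))).
have -> : (decide w [::] (fun _ => slot0)).1 = (guess K L w [::] A1).1.
  rewrite -[RHS]/(true && (guess K L w [::] A1).1) -[in RHS]v1.
  by rewrite /decide /procedure /mbind.
have qN : nprob F <= size w by have := size_encode F; rewrite -/w; lia.
pose P v := exists vp vn vu, [/\ v = vp ++ vn ++ vu, size vp = K1, size vn = K1, size vu = K2 &
  (exists A, xmodel (F := F) (guessed vp vn) A) /\
  (rho * (2 ^ nprob F)%:R <= (branch_sum (size w) F (guessed vp vn) vu)%:R)%R].
have LP v A : size v = K -> tags_ok (nexist F) (nprob F) A ->
    ((L w v A).1 <-> P v) /\ tags_ok (nexist F) (nprob F) (L w v A).2.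
  move=> sv Aok'.
  have [vp [vn [vu [vE sp sn su]]]] : exists vp vn vu,
      [/\ v = vp ++ vn ++ vu, size vp = K1, size vn = K1 & size vu = K2].
    exists (take K1 v), (take K1 (drop K1 v)), (drop K1 (drop K1 v)).
    split; first by rewrite !cat_take_drop.
    - by rewrite size_takel // sv /K; lia.
    - by rewrite size_takel // size_drop sv /K; lia.
    - by rewrite !size_drop sv /K; lia.
  rewrite vE /L /mbind; have [satE ok'] := @satisfiableE K1 K2 F vp vn vu sp sn su A Aok'.
  have cE := thresholdE sp sn su hJ ok'.
  have cE2 := count_branchesE sp sn su (@threshold R rho K2 J) ok'.
  rewrite -/w in satE ok' cE cE2; rewrite cE2 [LHS]/= in cE.
  rewrite cE2 /mret /= cE; split=> //.
  split=> [/andP[/satE xA h]|[vp' [vn' [vu' [E sp' sn' su' [xA h]]]]]].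
    by exists vp, vn, vu.
  (* The lengths being fixed, the concatenation determines the three lists. *)
  have /andP[/eqP Ep /eqP Enu] : (vp == vp') && (vn ++ vu == vn' ++ vu').
    by rewrite -eqseq_cat ?sp ?sp' // E.
  have /andP[/eqP En /eqP Eu] : (vn == vn') && (vu == vu').
    by rewrite -eqseq_cat ?sn ?sn' // Enu.
  by subst vp' vn' vu'; apply/andP; split=> //; apply/satE.
have [gE _] := guessP (n := K) (v := [::]) LP erefl Aok.
apply: iff_trans gE _.
have fg := e_frac_guess rho_gt0 rho_kappa qN.
split=> [[u [su au [vp [vn [vu [uE sp sn suu h]]]]]]|/fg [vp [vn [vu [sp sn su [ap an au] h]]]]].
  apply/fg; exists vp, vn, vu; split=> //.
  by move: au; rewrite /= in uE *; rewrite uE !all_cat => /and3P.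
exists (vp ++ vn ++ vu); split.
- by rewrite !size_cat sp sn su addnA.
- by rewrite !all_cat ap an au.
- by exists vp, vn, vu.
Qed.

Lemma decideP w : (decide w [::] (fun _ => slot0)).1 <->
  exists2 F, w = encode_cnf2 F & e_frac rho F.
Proof.
split=> [d|[F -> /decide_encode //]].
have [F wF] : exists F, w = encode_cnf2 F.
  have : (validate (K + 3) w [::] (fun _ => slot0)).1.
    by move: d; rewrite /decide /procedure /mbind /mret /= => /andP[].
  exact: validate_sound.
by exists F => //; apply/decide_encode; rewrite -wF.
Qed.

End Procedure.

(** * Running time *)

(** [14 = 2 + 2 + 10] pointers per unit of [kappa] for the two lists of literals and the hitting
    set; [148 = 144 + 4] includes the layout of the cells. *)
Definition time_bound (kappa n : nat) : nat :=
  (23 * 2 ^ (10 * kappa) + 4 * (14 * kappa) + 148) * (n + 2) ^ (14 * kappa + 5).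

(** The second conclusion is about each [F] encoded by [w], which spares an injectivity argument for
    the encoding. *)
Lemma decider (R : realType) (rho : R) (kappa : nat) :
  (0 < rho)%R -> ((4%:R^-1) ^+ kappa < rho)%R ->
  exists M : tm, forall w t, time_bound kappa (size w) <= t ->
    decides_within M w t (exists2 F, w = encode_cnf2 F & e_frac rho F) /\
    forall F, w = encode_cnf2 F -> decides_within M w t (e_frac rho F).
Proof.
move=> rho0 rhok; have [J hJ] := nweight_truncate (2 ^ (10 * kappa)) rho.
have cp := @computes_procedure (2 * kappa) (10 * kappa) J (@threshold R rho (10 * kappa) J).
rewrite [_ + 5]addnS in cp.
have [M MP] := computes_decides slot0 cp.
exists M => w t wt.
have {}wt : (23 * 2 ^ (10 * kappa) + 4 * (2 * kappa + 2 * kappa + 10 * kappa) + 144 + 4) *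
    (size w + 2) ^ (2 * kappa + 2 * kappa + 10 * kappa + 4).+1 <= t.
  apply: leq_trans wt; rewrite /time_bound.
  have -> : 2 * kappa + 2 * kappa + 10 * kappa = 14 * kappa by lia.
  by rewrite -addnA -addnS.
split=> [|F wF]; apply: MP => //; first exact: decideP.
by rewrite wF; apply: decide_encode.
Qed.

Lemma time_bound_poly kappa : exists k, forall n, time_bound kappa n <= k * n ^ k + k.
Proof.
rewrite /time_bound; set C := _ + 148; set a := _ + 5.
(* For positive [n], [n + 2 <= 3 * n]; this witness also bounds the exponent [a], and the value at
   [n = 0]. *)
exists (C * 3 ^ a) => -[|n]; set k := C * 3 ^ a.
  apply: leq_trans (leq_addl _ _); rewrite leq_mul2l leq_exp2r ?orbT //.
  by rewrite /a addn_gt0 orbT.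
apply: leq_trans (leq_addr _ _); rewrite /k -mulnA leq_mul2l -/k; apply/orP; right.
apply: (@leq_trans ((3 * n.+1) ^ a)); first by rewrite leq_exp2r ?/a ?addn_gt0 ?orbT //; lia.
rewrite expnMn leq_mul2l leq_pexp2l ?orbT // /k.
apply: leq_trans (ltnW (ltn_expl a (isT : 1 < 3))) _.
by apply: leq_pmull; rewrite /C addn_gt0 orbT.
Qed.

Lemma sumn_le (s : seq nat) m : (forall x, x \in s -> x <= m) -> sumn s <= size s * m.
Proof.
elim: s => //= x s IH h; rewrite mulSn leq_add ?h ?inE ?eqxx // IH // => y ys.
by rewrite h // inE ys orbT.
Qed.

Lemma size_encode_seq T (enc : T -> seq bool) (s : seq T) :
  size (encode_seq enc s) = (sumn [seq (size (enc a)).+1 | a <- s]).+1.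
Proof. by rewrite size_rcons size_flatten /shape -map_comp. Qed.

(** Distinct clauses over [m <= 2 * V] literals number at most [1 + m + m ^ 2 <= 6 * V ^ 2], each
    taking at most [6 * V] bits; [2 <= V] lets [V ^ 6] absorb the constant 64. *)
Lemma size_encode_uniq F : uniq (clauses F) ->
  size (encode_cnf2 F) + 2 <= maxn 2 (nvars F) ^ 9.
Proof.
move=> u; set V := maxn 2 (nvars F).
have V2 : 2 <= V by rewrite leq_maxl.
have VF : nexist F + nprob F <= V by apply: leq_maxr.
have size_lit (l : literal (nexist F) (nprob F)) : size (encode_literal l) <= V + 2.
  rewrite encode_literalE /= size_rcons size_nseq /lit_index.
  by case: (l.1) => i; have := ltn_ord i; lia.
have size_cl (C : 2.-bseq (literal (nexist F) (nprob F))) :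
    (size (encode_seq (@encode_literal _ _) C)).+1 <= 6 * V.
  rewrite size_encode_seq; apply: (@leq_trans (2 * (V + 3)).+2); last by lia.
  rewrite !ltnS; apply: (@leq_trans (size C * (V + 3))).
    rewrite -[size C](size_map (fun a => (size (encode_literal a)).+1)).
    by apply: sumn_le => x /mapP[l _ ->]; rewrite addnS ltnS.
  by rewrite leq_mul2r size_bseq orbT.
have ncl : size (clauses F) <= 6 * V ^ 2.
  rewrite -(card_uniqP u); apply: leq_trans (max_card _) _.
  rewrite card_bseq !big_ord_recr big_ord0 /= card_prod card_sum !card_ord card_bool.
  set m := _ * 2; have : m <= 2 * V by rewrite /m mulnC leq_mul2l.
  rewrite expn0 expn1; nia.
have total : size (encode_cnf2 F) + 2 <= 64 * V ^ 3.
  rewrite /encode_cnf2 !size_cat size_encode_seq /encode_nat !size_rcons !size_nseq.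
  set s := sumn _; have : s <= size (clauses F) * (6 * V).
    rewrite -(size_map (fun a : 2.-bseq _ => (size (encode_seq (@encode_literal _ _) a)).+1)).
    by apply: sumn_le => x /mapP[C _ ->].
  have : size (clauses F) * (6 * V) <= 36 * V ^ 3.
    rewrite (_ : 36 * V ^ 3 = (6 * V ^ 2) * (6 * V)); first by rewrite leq_mul2r ncl orbT.
    by rewrite !expnS; lia.
  have : V <= V ^ 3 by rewrite -[X in X <= _]expn1 leq_pexp2l // ltnW.
  lia.
apply: leq_trans total _; rewrite -[9]/(6 + 3) expnD leq_mul2r; apply/orP; right.
by rewrite -[64]/(2 ^ 6) leq_exp2r.
Qed.

(** [188 = 17 + 9 * 19]: the leading factor is at most [2 ^ (17 * kappa)], and
    [14 * kappa + 5 <= 19 * kappa]. *)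
Lemma time_bound_exp kappa n V : 0 < kappa -> 2 <= V -> n + 2 <= V ^ 9 ->
  time_bound kappa n <= V ^ (188 * kappa).
Proof.
move=> k0 V2 nV; rewrite /time_bound.
have C17 : 23 * 2 ^ (10 * kappa) + 4 * (14 * kappa) + 148 <= 2 ^ (17 * kappa).
  have e1 : 2 ^ (17 * kappa) = 2 ^ (7 * kappa) * 2 ^ (10 * kappa).
    by rewrite -expnD -mulnDl.
  have h7 : 2 ^ 7 <= 2 ^ (7 * kappa) by rewrite leq_exp2l // leq_pmulr.
  have h10 : 2 ^ 10 <= 2 ^ (10 * kappa) by rewrite leq_exp2l // leq_pmulr.
  have hk : kappa < 2 ^ (10 * kappa).
    by apply: leq_trans (ltn_expl kappa (isT : 1 < 2)) _; rewrite leq_exp2l // leq_pmull.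
  rewrite e1; move: h7 h10 hk; set x := 2 ^ (7 * _); set y := 2 ^ (10 * _).
  rewrite -[2 ^ 7]/128 -[2 ^ 10]/1024 => h7 h10 hk; nia.
rewrite (_ : 188 * kappa = 17 * kappa + 9 * (19 * kappa)); last by lia.
rewrite [X in _ <= X]expnD; apply: leq_mul.
  by apply: leq_trans C17 _; rewrite leq_exp2r // muln_gt0.
rewrite [X in _ <= X]expnM; apply: (@leq_trans ((V ^ 9) ^ (14 * kappa + 5))).
  by rewrite leq_exp2r // addn_gt0 orbT.
by rewrite leq_pexp2l ?expn_gt0 ?(ltnW V2) //; lia.
Qed.

Lemma expR1_le4 (R : realType) : (expR 1 <= 4%:R :> R)%R.
Proof.
have h : (2%:R^-1 <= expR (- 2%:R^-1) :> R)%R.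
  by apply: le_trans (expR_ge1Dx _); lra.
have h2 : (expR (2%:R^-1) <= 2%:R :> R)%R.
  rewrite expRN in h; rewrite -[leRHS]invrK -[leLHS]invrK lef_pV2 //.
    by rewrite posrE invr_gt0 expR_gt0.
  by rewrite posrE invr_gt0 ltr0n.
have -> : (expR 1 = expR (2%:R^-1) * expR (2%:R^-1) :> R)%R.
  by rewrite -expRD; congr expR; field.
by apply: le_trans (ler_pM _ _ h2 h2) _; rewrite ?expR_ge0 //; lra.
Qed.

(** With [L] the maximum, [kappa] is the integer part of [L] plus one: at most [2 * L] as [1 <= L],
    while [4 ^ kappa >= e ^ kappa > 1 / rho]. *)
Lemma exists_kappa (R : realType) (rho : R) : (0 < rho)%R ->
  exists kappa : nat, [/\ 0 < kappa, ((4%:R^-1) ^+ kappa < rho)%R &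
    (kappa%:R <= 2%:R * Num.max 1 (ln rho^-1))%R].
Proof.
move=> rho0; set L := Num.max 1%R (ln rho^-1).
have L1 : (1 <= L)%R by rewrite /L le_max lexx.
have L0 : (0 <= L)%R by apply: le_trans L1.
exists (Num.truncn L).+1; split=> //; last first.
  rewrite -natr1; have := truncn_le L; rewrite L0; lra.
have h1 : (ln rho^-1 < (Num.truncn L).+1%:R)%R.
  by apply: le_lt_trans (truncnS_gt _); rewrite /L le_max lexx orbT.
have h2 : (rho^-1 < 4%:R ^+ (Num.truncn L).+1)%R.
  rewrite -[ltLHS]lnK ?posrE ?invr_gt0 //.
  apply: (@lt_le_trans _ _ (expR (Num.truncn L).+1%:R)); first by rewrite ltr_expR.
  rewrite -[X in expR X]mulr1 expRM_natl; apply: lerXn2r; rewrite ?nnegrE ?expR_ge0 //.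
  exact: expR1_le4.
rewrite exprVn -[ltRHS]invrK ltf_pV2 ?posrE ?exprn_gt0 ?invr_gt0 //.
Qed.

Lemma e_majE (R : realType) F : e_maj F <-> e_frac (2%:R^-1 : R)%R F.
Proof.
have c0 : (0 < (2 ^ nprob F)%:R :> R)%R by rewrite ltr0n expn_gt0.
suff E (A : xassign F) : (2 ^ nprob F <= 2 * nsat A) =
    (2%:R^-1 <= (nsat A)%:R / (#|{: yassign F}|)%:R :> R)%R.
  by split=> -[A hA]; exists A; move: hA; rewrite E.
rewrite card_ffun card_bool card_ord ler_pdivlMr // mulrC ler_pdivrMr ?ltr0n //.
by rewrite -natrM ler_nat mulnC.
Qed.

Local Open Scope ring_scope.


(* The constant [c] hidden in the O of the exponent does not depend on rho.
   [maxn 2 n] and [Num.max 1 _] only matter for n < 2 and for log(1/rho) < 1,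
   where the literal n^(c log(1/rho)) would be smaller than the input.
   Clauses are not repeated, so that the size of F is polynomial in n. *)
Theorem theorem6p1 (R : realType) :
  in_P E_MAJ_2SAT /\
  exists c : nat, forall rho : R, 0 < rho -> rho < 1 ->
    exists M : tm, forall F : cnf2, uniq (clauses F) ->
      exists t : nat,
        t%:R <= (maxn 2 (nvars F))%:R `^ (c%:R * Num.max 1 (ln rho^-1)) /\
        decides_within M (encode_cnf2 F) t (e_frac rho F).
Proof.
split.
  have rho0 : 0 < 2%:R^-1 :> R by rewrite invr_gt0.
  have [|M MP] := @decider R 2%:R^-1 1 rho0; first by rewrite expr1 ltf_pV2 ?posrE ?ltr_nat.
  have [k hk] := time_bound_poly 1.
  exists M, k => w; have [[b Mb bQ] _] := MP w _ (hk _); exists b => //.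
  by rewrite bQ; split=> -[F wF hF]; exists F => //; apply/(@e_majE R).
(* [376 = 2 * 188], from [kappa <= 2 * L] and the bound [V ^ (188 * kappa)]. *)
exists 376 => rho rho0 rho1.
have [kappa [k0 krho kL]] := exists_kappa rho0.
have [M MP] := decider rho0 krho; exists M => F uF.
set V := maxn 2 (nvars F).
exists (V ^ (188 * kappa))%N; split.
  have V1 : 1 <= V%:R :> R by rewrite ler1n (leq_trans _ (leq_maxl _ _)).
  rewrite natrX -powR_mulrn ?ler0n // ler_powR // natrM.
  by move: kL; set L := Num.max _ _ => kL; lra.
have hw := time_bound_exp k0 (leq_maxl 2 (nvars F)) (size_encode_uniq uF).
by have [_] := MP _ _ hw; apply.
Qed.
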